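(* Let $\eta>0$ be a constant such that $\|B(u,v)\|_{\mathcal X}\le\eta\|u\|_{\mathcal X}\|v\|_{\mathcal X}$ for all $u,v\in\mathcal X=\mathcal C_w([0,\infty),\mathcal{PM}^2)$ (such a constant exists), and let $0<\varepsilon<1/(4\eta)$. Let $u_0,v_0\in\mathcal{PM}^2$ and $F,G\in\mathcal C_w([0,\infty),\mathcal{PM})$ satisfy $\|u_0\|_{\mathcal{PM}^2}+\|F\|_{\mathcal C_w([0,\infty),\mathcal{PM})}<\varepsilon$ and $\|v_0\|_{\mathcal{PM}^2}+\|G\|_{\mathcal C_w([0,\infty),\mathcal{PM})}<\varepsilon$. Let $u$ and $v$ be the (unique) solutions in $\mathcal X$ of the Navier--Stokes problem corresponding to $(u_0,F)$ and $(v_0,G)$, respectively, with $\|u\|_{\mathcal X}\le2\varepsilon$ and $\|v\|_{\mathcal X}\le2\varepsilon$. Suppose that $$\lim_{t\to\infty}\|S(t)(u_0-v_0)\|_{\mathcal{PM}^2}=0\quad\text{and}\quad\lim_{t\to\infty}\|F(t)-G(t)\|_{\mathcal{PM}}=0.$$ Then $$\lim_{t\to\infty}\|u(\cdot,t)-v(\cdot,t)\|_{\mathcal{PM}^2}=0.$$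
   Context: The Fourier transform on $\mathbb{R}^3$ is $\widehat v(\xi)=(2\pi)^{-3/2}\int_{\mathbb{R}^3}e^{-ix\cdot\xi}v(x)\,dx$, extended to tempered distributions. For $a\ge0$, $\mathcal{PM}^a=\{v\in\mathcal S'(\mathbb{R}^3):\widehat v\in L^1_{loc}(\mathbb{R}^3),\ \|v\|_{\mathcal{PM}^a}=\operatorname{ess\,sup}_{\xi\in\mathbb{R}^3}|\xi|^a|\widehat v(\xi)|<\infty\}$, and $\mathcal{PM}=\mathcal{PM}^0$. The same notation is used for vector-valued $v=(v_1,v_2,v_3)$, with $|\widehat v(\xi)|$ the Euclidean norm. All data, forces and solutions are vector valued with three components. $\mathcal C_w([0,\infty),\mathcal{PM}^a)$ is the space of bounded functions $u:[0,\infty)\to\mathcal{PM}^a$ that are weakly continuous as distributions ($t\mapsto\langle u(t),\varphi\rangle$ is continuous for every Schwartz function $\varphi$), with norm $\sup_{t\ge0}\|u(t)\|_{\mathcal{PM}^a}$. $S(t)$ is the heat semigroup, $\widehat{S(t)v}(\xi)=e^{-t|\xi|^2}\widehat v(\xi)$. $\mathbb{P}$ is the Leray projector, with matrix symbol $(\widehat{\mathbb{P}}(\xi))_{j,k}=\delta_{jk}-\xi_j\xi_k/|\xi|^2$. For $u,v\in\mathcal{PM}^2$, $\widehat{u_kv_j}=(2\pi)^{-3/2}\,\widehat u_k*\widehat v_j$, $u\otimes v$ is the matrix with entries $u_kv_j$, and $i\xi\cdot\widehat{(u\otimes v)}$ is the vector with $j$-th component $\sum_k i\xi_k\widehat{u_kv_j}$.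 The bilinear operator $B$ is defined by $\widehat{B(u,v)}(\xi,t)=-\int_0^te^{-(t-\tau)|\xi|^2}\widehat{\mathbb{P}}(\xi)\,i\xi\cdot\widehat{(u\otimes v)}(\xi,\tau)\,d\tau$. The Navier--Stokes problem is $u_t-\Delta u+(u\cdot\nabla)u+\nabla p=F$, $\nabla\cdot u=0$, $u(0)=u_0$ on $\mathbb{R}^3$. By a solution corresponding to $(u_0,F)$ we mean $u\in\mathcal C_w([0,\infty),\mathcal{PM}^2)$ such that for all $t\ge0$ $$\widehat u(\xi,t)=e^{-t|\xi|^2}\widehat u_0(\xi)-\int_0^te^{-(t-\tau)|\xi|^2}\widehat{\mathbb{P}}(\xi)\,i\xi\cdot\widehat{(u\otimes u)}(\xi,\tau)\,d\tau+\int_0^te^{-(t-\tau)|\xi|^2}\widehat{\mathbb{P}}(\xi)\widehat F(\xi,\tau)\,d\tau .$$ Whenever $u_0\in\mathcal{PM}^2$ and $F\in\mathcal C_w([0,\infty),\mathcal{PM})$ satisfy $\|u_0\|_{\mathcal{PM}^2}+\|F\|_{\mathcal C_w([0,\infty),\mathcal{PM})}<\varepsilon$ with $0<\varepsilon<1/(4\eta)$, where $\eta>0$ is a constant such that $\|B(u,v)\|_{\mathcal X}\le\eta\|u\|_{\mathcal X}\|v\|_{\mathcal X}$ for all $u,v\in\mathcal X=\mathcal C_w([0,\infty),\mathcal{PM}^2)$, there is a unique solution $u$ corresponding to $(u_0,F)$ with $\|u\|_{\mathcal X}\le2\varepsilon$. *)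

(* Defs.v *)
From HB Require Import structures.
From mathcomp Require Import all_boot all_order all_algebra.
From mathcomp Require Import all_classical all_reals all_analysis.
From mathcomp Require Import ess_sup_inf complex.

Set Implicit Arguments.
Unset Strict Implicit.
Unset Printing Implicit Defensive.

Import Order.TTheory GRing.Theory Num.Theory.
Import numFieldNormedType.Exports.

Local Open Scope classical_set_scope.
Local Open Scope complex_scope.
Local Open Scope ring_scope.

Notation normc := ComplexField.Normc.normc.

Section complex_integral.
Context (d : measure_display) (T : measurableType d) (R : realType).
Implicit Types (mu : {measure set T -> \bar R}) (D : set T) (f : T -> R[i]).

Definition cmeasurable D f : Prop :=
  measurable_fun D (fun x => complex.Re (f x)) /\
  measurable_fun D (fun x => complex.Im (f x)).

Definition cintegrable mu D f : Prop :=
  mu.-integrable D (fun x => (complex.Re (f x))%:E) /\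
  mu.-integrable D (fun x => (complex.Im (f x))%:E).

Definition cint mu D f : R[i] :=
  Rintegral mu D (fun x => complex.Re (f x)) +i*
  Rintegral mu D (fun x => complex.Im (f x)).

End complex_integral.

(* The library registers the product of two sigma-finite measures as a measure
   only; sigma-finiteness is what Fubini's theorem and iteration need. *)
Lemma sigma_finite_prod (R : realType) (d1 d2 : measure_display)
    (T1 : measurableType d1) (T2 : measurableType d2)
    (m1 : {sigma_finite_measure set T1 -> \bar R})
    (m2 : {sigma_finite_measure set T2 -> \bar R}) :
  sigma_finite setT (m1 \x m2)%E.
Proof.
have /sigma_finiteP[F [TF ndF Foo]] := sigma_finiteT m1.
have /sigma_finiteP[G [TG ndG Goo]] := sigma_finiteT m2.
exists (fun n => F n `*` G n).
  rewrite -setXTT TF TG predeqE => -[x y]; split.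
    move=> [/= [n _ Fnx] [k _ Gky]]; exists (maxn n k) => //; split.
    - by move: x Fnx; exact/subsetPset/ndF/leq_maxl.
    - by move: y Gky; exact/subsetPset/ndG/leq_maxr.
  by move=> [n _ []/= ? ?]; split; exists n.
move=> k; have [? ?] := Foo k; have [? ?] := Goo k.
split; first exact: measurableX.
by rewrite product_measure1E// lte_mul_pinfty// ge0_fin_numE.
Qed.

Section lebesgue_measure_R3.
Variable R : realType.
Local Notation mR := (measurableTypeR R).

Definition leb2 : set (mR * mR)%type -> \bar R :=
  (@lebesgue_measure R \x @lebesgue_measure R)%E.

HB.instance Definition _ := Measure.on leb2.
HB.instance Definition _ := Measure_isSigmaFinite.Build _ _ _ leb2
  (sigma_finite_prod (@lebesgue_measure R) (@lebesgue_measure R)).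

Definition leb3 : set (mR * mR * mR)%type -> \bar R :=
  (leb2 \x @lebesgue_measure R)%E.

HB.instance Definition _ := Measure.on leb3.
HB.instance Definition _ := Measure_isSigmaFinite.Build _ _ _ leb3
  (sigma_finite_prod leb2 (@lebesgue_measure R)).

End lebesgue_measure_R3.

Section pseudomeasures.
Variable R : realType.

Local Notation mR := (measurableTypeR R).
Local Notation mR3 := (mR * mR * mR)%type.
Local Notation R3 := (R * R * R)%type.
Local Notation C := R[i].
Local Notation C3 := ('I_3 -> R[i]).
Local Notation leb1 := (@lebesgue_measure R).
Local Notation leb3 := (@leb3 R).

Definition coord (x : R3) (j : 'I_3) : R :=
  tnth [tuple x.1.1; x.1.2; x.2] j.

Definition basis (j : 'I_3) : R3 :=
  ((j == 0%N :> nat)%:R, (j == 1%N :> nat)%:R, (j == 2%N :> nat)%:R).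

Definition dot (x y : R3) : R := \sum_(j < 3) coord x j * coord y j.

Definition enorm (x : R3) : R := Num.sqrt (dot x x).

Definition cnorm (w : C3) : R := Num.sqrt (\sum_(j < 3) normc (w j) ^+ 2).

Definition partials (s : seq 'I_3) (f : R3 -> R) : R3 -> R :=
  foldr (fun j g => fun x => 'D_(basis j) g x) f s.

(* Boundedness of all iterated partial derivatives makes each of them
   Lipschitz, so the existence of all of them already gives smoothness. *)
Definition rschwartz (f : R3 -> R) : Prop :=
  (forall (s : seq 'I_3) (j : 'I_3) (x : R3),
     derivable (partials s f) x (basis j)) /\
  (forall (s : seq 'I_3) (k : nat), exists M : R, forall x : R3,
     (1 + enorm x) ^+ k * `|partials s f x| <= M).

Definition schwartz (phi : R3 -> C) : Prop :=
  rschwartz (fun x => complex.Re (phi x)) /\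
  rschwartz (fun x => complex.Im (phi x)).

Definition cpartials (s : seq 'I_3) (phi : R3 -> C) (x : R3) : C :=
  partials s (fun y => complex.Re (phi y)) x +i*
  partials s (fun y => complex.Im (phi y)) x.

Definition fourier (phi : R3 -> C) (xi : R3) : C :=
  ((2 * pi) `^ (- (3 / 2)))%:C *
  cint leb3 setT
    (fun x => (cos (dot x xi) -i* sin (dot x xi)) * phi x).

(* Functionals are total on all functions R^3 -> C; only their values on
   Schwartz functions are meaningful. *)
Definition functional : Type := (R3 -> C) -> C.

Definition tempered (T : functional) : Prop :=
  (forall (a : C) (phi psi : R3 -> C), schwartz phi -> schwartz psi ->
     T (fun x => a * phi x + psi x) = a * T phi + T psi) /\
  (exists (N : nat) (A : R), forall (phi : R3 -> C) (M : R), schwartz phi ->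
     (forall (k : nat) (s : seq 'I_3) (x : R3), (k <= N)%N -> (size s <= N)%N ->
        (1 + enorm x) ^+ k * normc (cpartials s phi x) <= M) ->
     normc (T phi) <= A * M).

(* The Fourier transform of T, defined by duality, is the locally integrable
   function f. The integrability of f * phi makes the pairing of f with
   Schwartz functions meaningful; it is automatic when |xi|^a f is essentially
   bounded for some a >= 0. *)
Definition fourier_rep (T : functional) (f : R3 -> C) : Prop :=
  [/\ cmeasurable (setT : set mR3) f,
      forall r : R, cintegrable leb3 [set xi : mR3 | enorm xi <= r] f
    & forall phi : R3 -> C, schwartz phi ->
        cintegrable leb3 setT (fun xi => f xi * phi xi) /\
        T (fourier phi) = cint leb3 setT (fun xi => f xi * phi xi)].

Definition vdist : Type := 'I_3 -> functional.

Definition vfourier_rep (v : vdist) (f : R3 -> C3) : Prop :=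
  forall j : 'I_3, fourier_rep (v j) (fun xi => f xi j).

(* A representative of the Fourier transform of v; it is determined up to
   almost everywhere equality (junk value 0 if there is none). *)
Definition hat (v : vdist) : R3 -> C3 :=
  xget (fun _ _ => 0) [set f | vfourier_rep v f].

(* The PM^a norm of the distribution with Fourier transform f. Used directly for
   S(t) v and B(u, v), which are defined through their Fourier transforms. *)
Definition hatnorm (a : R) (f : R3 -> C3) : \bar R :=
  ess_sup leb3 (fun xi => (enorm xi `^ a * cnorm (f xi))%:E).

Definition PMnorm (a : R) (v : vdist) : \bar R := hatnorm a (hat v).

Definition PM (a : R) (v : vdist) : Prop :=
  [/\ forall j : 'I_3, tempered (v j),
      exists f : R3 -> C3, vfourier_rep v f
    & (PMnorm a v < +oo)%E].

Definition hatnormX (a : R) (f : R -> R3 -> C3) : \bar R :=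
  ereal_sup [set hatnorm a (f t) | t in [set t : R | 0 <= t]].

Definition CwPMnorm (a : R) (u : R -> vdist) : \bar R :=
  hatnormX a (fun t => hat (u t)).

(* Functions of time are total on R; only their values at t >= 0 matter. *)
Definition CwPM (a : R) (u : R -> vdist) : Prop :=
  [/\ forall t : R, 0 <= t -> PM a (u t),
      (CwPMnorm a u < +oo)%E
    & forall (j : 'I_3) (phi : R3 -> C), schwartz phi ->
        {within `[0, +oo[, continuous (fun t : R => complex.Re (u t j phi))} /\
        {within `[0, +oo[, continuous (fun t : R => complex.Im (u t j phi))}].

(* The function (xi, t) |-> \hat u(xi, t) entering time integrals at fixed xi:
   a choice, measurable in (t, xi) jointly, of representatives of the Fourier
   transforms of the u(t). Every element of C_w([0, oo), PM^a) has one, and any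
   two agree almost everywhere in (t, xi). *)
Definition spacetime_hat (u : R -> vdist) (uh : R -> R3 -> C3) : Prop :=
  (forall j : 'I_3, cmeasurable
     ([set p : mR * mR3 | 0 <= (p.1 : R)] : set (mR * mR3)%type)
     (fun p => uh p.1 p.2 j)) /\
  (forall t : R, 0 <= t -> {ae leb3, forall xi, uh t xi = hat (u t) xi}).

Definition heat (t : R) (xi : R3) : C := (expR (- (t * dot xi xi)))%:C.

Definition heat_hat (t : R) (v : vdist) : R3 -> C3 :=
  fun xi j => heat t xi * hat v xi j.

Definition leray (xi : R3) (w : C3) : C3 := fun j =>
  \sum_(k < 3)
    ((j == k)%:R - coord xi j * coord xi k / dot xi xi)%:C * w k.

Definition conv (f g : R3 -> C) (xi : R3) : C :=
  cint leb3 setT (fun y : R3 => f (xi - y) * g y).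

(* Fourier transform of u_k v_j, for f and g those of u and v. *)
Definition tensor_hat (f g : R3 -> C3) (xi : R3) (k j : 'I_3) : C :=
  ((2 * pi) `^ (- (3 / 2)))%:C *
  conv (fun y => f y k) (fun y => g y j) xi.

Definition div_tensor_hat (f g : R3 -> C3) (xi : R3) : C3 := fun j =>
  \sum_(k < 3) (0 +i* coord xi k) * tensor_hat f g xi k j.

Definition B_hat (uh vh : R -> R3 -> C3) : R -> R3 -> C3 := fun t xi j =>
  - cint leb1 `[0, t] (fun tau : R =>
      heat (t - tau) xi * leray xi (div_tensor_hat (uh tau) (vh tau) xi) j).

Definition force_hat (Fh : R -> R3 -> C3) : R -> R3 -> C3 := fun t xi j =>
  cint leb1 `[0, t] (fun tau : R =>
    heat (t - tau) xi * leray xi (Fh tau xi) j).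

Definition B_bounded (eta : R) : Prop :=
  forall u v : R -> vdist, CwPM 2 u -> CwPM 2 v ->
  forall uh vh : R -> R3 -> C3, spacetime_hat u uh -> spacetime_hat v vh ->
  (hatnormX 2 (B_hat uh vh) <= eta%:E * CwPMnorm 2 u * CwPMnorm 2 v)%E.

Definition NS_solution (u0 : vdist) (F u : R -> vdist) : Prop :=
  CwPM 2 u /\
  exists uh Fh : R -> R3 -> C3,
    [/\ spacetime_hat u uh, spacetime_hat F Fh
      & forall t : R, 0 <= t -> {ae leb3, forall xi, forall j : 'I_3,
          uh t xi j = heat t xi * hat u0 xi j + B_hat uh uh t xi j
                      + force_hat Fh t xi j}].

End pseudomeasures.

(* Main.v *)
(** Applied to fields constant in time, the bound on B gives, as t tends to
    infinity, a pointwise bound with the same constant [eta] on the symbol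
    [P(xi) i xi . (u (x) v)^(xi)] for a.e. [xi]. For [w = u - v] and
    [q = 4 eta eps < 1], Duhamel's formula then bounds [|xi|^2 |w^(xi, t)|] by the
    heat term plus the integral over [0, t] of [|xi|^2 e^(-(t - tau) |xi|^2)] times
    [q |w(tau)| + C |F(tau) - G(tau)|] (norms of PM^2 and PM). If [|w| <= a] after
    time T0, the times before T0 contribute O(T0 / (t - T0)), because
    [x e^(-x) <= 1], and the later ones at most [q a] plus a vanishing force
    term. Hence an eventual bound [a] improves to [q a + e] for every [e > 0];
    iterating gives the limit 0.

    Differences of Fourier transforms make sense because a distribution has only
    one Fourier transform up to null sets, which is tested on Gaussian-type
    products; the convolutions split by linearity because
    [|xi - y|^-2 |y|^-2] is integrable in y as soon as no coordinate of [xi]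
    vanishes. *)

From HB Require Import structures.
From mathcomp Require Import all_boot all_order all_algebra.
From mathcomp Require Import all_classical all_reals all_analysis.
From mathcomp Require Import ess_sup_inf measurable_realfun complex.
From mathcomp Require Import ring lra.
Require Import Defs.

Set Implicit Arguments.
Unset Strict Implicit.
Unset Printing Implicit Defensive.

Import Order.TTheory GRing.Theory Num.Theory.
Import numFieldNormedType.Exports.

Local Open Scope classical_set_scope.
Local Open Scope ring_scope.

(** * Schwartz functions separate measurable functions *)

(** The iteration contracts only because q = 4 eta eps < 1, so the constant [eta] must not
    deteriorate on the way to pointwise bounds. This is why the bound on the symbol is recovered
    from [B_bounded] itself and not from an explicit estimate of the convolution, and why
    vector-valued time integrals are estimated in the Euclidean norm and not component by component.
    Constants in the force term may be crude, as the force difference tends to 0.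

    The second obstacle is the order of the null sets: at each time the bounds hold for almost every
    frequency, whereas Duhamel integrals run over time at a fixed frequency. Exchanging the two
    requires measurability of the nonlinear symbol jointly in time and frequency.

    The norm of w(tau) enters only through one constant up to T0 and another one afterwards, so it
    is never integrated as a function of time. *)

Section gaussian_polynomials.
Variable R : realType.
Local Notation R3 := (R * R * R)%type.

(** For fixed [q] this class is stable under differentiation, which makes all Schwartz seminorms
    accessible at once. The freedom in [q] is what later lets such functions approximate indicators
    of intervals. *)
Definition gpoly (q p : {poly R}) (x : R) : R := p.[x] * expR (- q.[x]).

Definition gderiv (q p : {poly R}) : {poly R} := p^`() - p * q^`().

Lemma is_derive_gpoly q p (x : R) :
  is_derive x 1 (gpoly q p) (gpoly q (gderiv q p) x).
Proof.
have H (r : {poly R}) : is_derive x 1 (horner r) (r^`()).[x].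
  apply: DeriveDef; first exact: derivable_horner.
  by rewrite -derive1E derivE.
have dq := H q; have dp := H p.
have -> : gpoly q p = (horner p) * (expR \o (- horner q)).
  by apply/funext => y.
apply: is_derive_eq.
rewrite /gpoly /gderiv hornerD hornerN hornerM /= !fctE.
rewrite /GRing.scale /=; ring.
Qed.

Lemma horner_le (p : {poly R}) :
  exists C : R, forall x, `|p.[x]| <= C * (1 + `|x|) ^+ size p.
Proof.
elim/poly_ind: p => [|p c [C IH]].
  by exists 0 => x; rewrite horner0 normr0 mul0r.
have C0 : 0 <= C.
  by have := IH 0; rewrite normr0 addr0 expr1n mulr1; apply: le_trans.
exists (C + `|c|) => x.
rewrite hornerMXaddC size_MXaddC; case: ifPn => [/andP[/eqP -> /eqP ->]|_].
  by rewrite horner0 mul0r addr0 normr0 expr0 mulr1 addr_ge0.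
rewrite (le_trans (ler_normD _ _))// mulrDl lerD//; last first.
  by rewrite ler_peMr// exprn_ege1// lerDl.
rewrite normrM exprSr mulrA ler_pM// lerDr//.
Qed.

Lemma exprn_gauss_le (k : nat) :
  exists C : R, forall x, (1 + `|x|) ^+ k * expR (- x ^+ 2) <= C.
Proof.
(* Raising 1 + t <= (k + 3) e^(t^2 / (k + 1)) to the power k + 1 produces exactly the factor
   e^(t^2). *)
exists (k.+3%:R ^+ k.+1) => x.
have t0 : 0 <= `|x| by [].
rewrite -(real_normK (num_real x)); set t := `|x| in t0 *.
have t1 : 1 + t <= k.+3%:R * expR (t ^+ 2 / k.+1%:R).
  apply: (@le_trans _ _ (k.+3%:R * (1 + t ^+ 2 / k.+1%:R))); last first.
    by rewrite ler_pM2l// expR_ge1Dx.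
  have -> : k.+3%:R * (1 + t ^+ 2 / k.+1%:R) =
     k.+3%:R + t ^+ 2 * (k.+3%:R / k.+1%:R) :> R by ring.
  have : t ^+ 2 <= t ^+ 2 * (k.+3%:R / k.+1%:R).
    by rewrite ler_peMr ?sqr_ge0// ler_pdivlMr ?ltr0Sn// mul1r ler_nat leqW.
  have : 3 <= k.+3%:R :> R by rewrite ler_nat.
  have : 1 + t <= 3 + t ^+ 2 by have := sqr_ge0 (t - 1); nra.
  move: (k.+3%:R) (t ^+ 2 * _) => K X; lra.
rewrite expRN ler_pdivrMr ?expR_gt0//.
have -> : expR (t ^+ 2) = expR (t ^+ 2 / k.+1%:R) ^+ k.+1.
  by rewrite -expRM_natl mulrC divfK.
rewrite -exprMn (@le_trans _ _ ((1 + t) ^+ k.+1))//.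
  by rewrite exprSr ler_peMr ?exprn_ge0 ?lerDl// addr_ge0.
by rewrite lerXn2r// nnegrE ?addr_ge0// mulr_ge0 ?expR_ge0.
Qed.

Lemma gpoly_le (q p : {poly R}) (k : nat) :
  (forall x, x ^+ 2 <= q.[x]) ->
  exists C : R, forall x, (1 + `|x|) ^+ k * `|gpoly q p x| <= C.
Proof.
move=> q2; have [C hC] := horner_le p.
have [D hD] := exprn_gauss_le (k + size p).
exists (C * D) => x.
have C0 : 0 <= C.
  by have := hC 0; rewrite normr0 addr0 expr1n mulr1; apply: le_trans.
rewrite normrM (ger0_norm (expR_ge0 _)).
apply: le_trans (ler_wpM2l C0 (hD x)).
rewrite exprD [leLHS]mulrA.
apply: (@le_trans _ _ ((1 + `|x|) ^+ k * (C * (1 + `|x|) ^+ size p) * expR (- x ^+ 2))); last first.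
  by rewrite le_eqVlt; apply/orP; left; apply/eqP; ring.
apply: ler_pM; rewrite ?expR_ge0//.
- by rewrite ler_wpM2l// exprn_ge0// addr_ge0.
- by rewrite ler_expR lerN2.
Qed.

Definition tensor3 (a : 'I_3 -> R -> R) (x : R3) : R :=
  \prod_(i < 3) a i (coord x i).

Lemma coord_shift (x : R3) (h : R) (i j : 'I_3) :
  coord (h *: basis R j + x) i = (i == j)%:R * h + coord x i.
Proof.
case: x => [[x1 x2] x3].
case: i => [[|[|[|//]]] ?]; case: j => [[|[|[|//]]] ?];
 rewrite /coord /basis !(tnth_nth 0) /= -?val_eqE /= ?scaler0 ?mul0r ?mul1r
   ?add0r // /GRing.scale /= ?mulr1 ?mulr0 ?add0r//.
Qed.

Lemma is_derive_tensor3 (a : 'I_3 -> R -> R) (x : R3) (j : 'I_3) (d : R) :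
  is_derive (coord x j) 1 (a j) d ->
  is_derive x (basis R j) (tensor3 a)
    (d * \prod_(i < 3 | i != j) a i (coord x i)).
Proof.
move=> [da dad]; set c := \prod_(i < 3 | _) _.
(* Along the j-th basis vector only the j-th factor varies, so the difference quotient is a
   one-variable quotient times the constant [c]. *)
have H : (fun h => h^-1 *: ((tensor3 a \o shift x) (h *: basis R j) - tensor3 a x))
  = (fun h => c * (h^-1 *: ((a j \o shift (coord x j)) (h *: 1) - a j (coord x j)))).
  have E y : tensor3 a y = a j (coord y j) * \prod_(i < 3 | i != j) a i (coord y i).
    by rewrite /tensor3 (bigD1 j).
  apply/funext => h /=; rewrite !E coord_shift eqxx mul1r.
  under eq_bigr => i /negbTE ij do rewrite coord_shift ij mul0r add0r.
  by rewrite /GRing.scale/= mulr1 -/c; ring.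
have L : (h^-1 *: ((tensor3 a \o shift x) (h *: basis R j) - tensor3 a x)) @[h --> 0^'] --> d * c.
  rewrite H mulrC; apply: cvgMr.
  by move: da; rewrite /derivable -dad.
apply: DeriveDef.
  by rewrite /derivable; apply/cvg_ex; exists (d * c); exact: L.
by rewrite /derive; apply/cvg_lim => //; exact: L.
Qed.

Lemma partials_tensor3 (q p : 'I_3 -> {poly R}) (s : seq 'I_3) :
  partials s (tensor3 (fun i => gpoly (q i) (p i))) =
  tensor3 (fun i => gpoly (q i) (iter (count_mem i s) (gderiv (q i)) (p i))).
Proof.
elim: s => //= j s ->; apply/funext => x.
have := @is_derive_tensor3
   (fun i => gpoly (q i) (iter (count_mem i s) (gderiv (q i)) (p i))) x j _
   (is_derive_gpoly _ _ _).
move/@derive_val => ->.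
rewrite /tensor3 [in RHS](bigD1 j)//= eqxx iterS; congr (_ * _).
by apply: eq_bigr => i /negbTE; rewrite eq_sym => ->.
Qed.

(** Distributes the weight of the Schwartz seminorms over the three factors of a [tensor3]. *)
Lemma enorm_le_coord (x : R3) : 1 + enorm x <= \prod_(i < 3) (1 + `|coord x i|).
Proof.
rewrite /enorm /dot !big_ord_recl !big_ord0 addr0 mulr1.
set u := coord _ _; set v := coord _ _; set w := coord _ _.
have := normr_ge0 u; have := normr_ge0 v; have := normr_ge0 w.
move: (real_normK (num_real u)) (real_normK (num_real v)) (real_normK (num_real w)).
move: `|u| `|v| `|w| => u' v' w' eu ev ew u0 v0 w0.
rewrite -!expr2 -eu -ev -ew.
apply: (@le_trans _ _ (1 + (u' + v' + w'))).
  rewrite lerD2l -[leRHS]ger0_norm ?addr_ge0// -sqrtr_sqr ler_wsqrtr//.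
  nra.
have uv := mulr_ge0 u0 v0; have uw := mulr_ge0 u0 w0; have vw := mulr_ge0 v0 w0.
have := mulr_ge0 uv w0.
nra.
Qed.

Lemma rschwartz_tensor3 (q p : 'I_3 -> {poly R}) :
  (forall i x, x ^+ 2 <= (q i).[x]) ->
  rschwartz (tensor3 (fun i => gpoly (q i) (p i))).
Proof.
move=> q2; split=> [s j x|s k]; rewrite partials_tensor3.
  have := @is_derive_tensor3
   (fun i => gpoly (q i) (iter (count_mem i s) (gderiv (q i)) (p i))) x j _
   (is_derive_gpoly _ _ _).
  by move/@ex_derive.
have /choice[C hC] : forall i : 'I_3, exists C : R, forall x, (1 + `|x|) ^+ k *
   `|gpoly (q i) (iter (count_mem i s) (gderiv (q i)) (p i)) x| <= C.
  by move=> i; apply: gpoly_le.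
exists (\prod_(i < 3) C i) => x.
apply: (@le_trans _ _ (\prod_(i < 3) ((1 + `|coord x i|) ^+ k *
   `|gpoly (q i) (iter (count_mem i s) (gderiv (q i)) (p i)) (coord x i)|))).
  rewrite big_split/= -normr_prod ler_wpM2r// prodrXl lerXn2r//.
  - by rewrite nnegrE addr_ge0// sqrtr_ge0.
  - by rewrite nnegrE prodr_ge0// => i _; rewrite addr_ge0.
  - exact: enorm_le_coord.
by apply: ler_prod => i _; rewrite hC andbT mulr_ge0// exprn_ge0// addr_ge0.
Qed.

End gaussian_polynomials.

(** * Vanishing integrals and Dynkin systems *)

Section dynkin_integral.
Local Open Scope ereal_scope.
Context d d' (T : measurableType d) (X : measurableType d') (R : realType).
Variable mu : {measure set T -> \bar R}.

(** The sets S with vanishing integral form a Dynkin system: complements are covered because the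
    integral over [E] is 0, disjoint unions by integrability of [g]. The map [f] and the fixed set
    [E] allow one coordinate to be enlarged to arbitrary measurable sets while the others stay
    fixed. *)
Lemma dynkin_integral_eq0 (f : T -> X) (G : set (set X)) (g : T -> \bar R)
    (E : set T) :
  measurable_fun setT f -> @measurable _ X = <<s G >> -> setI_closed G ->
  mu.-integrable setT g -> measurable E -> \int[mu]_(x in E) g x = 0 ->
  (forall S, G S -> \int[mu]_(x in E `&` f @^-1` S) g x = 0) ->
  forall S, measurable S -> \int[mu]_(x in E `&` f @^-1` S) g x = 0.
Proof.
move=> mf genG GI ig mE gE0 gG S mS.
have mfS A : measurable A -> measurable (E `&` f @^-1` A).
  by move=> mA; apply: measurableI => //; rewrite -[X in measurable X]setTI; exact: mf.
apply: (@dynkin_induction _ X G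
  [set A | \int[mu]_(x in E `&` f @^-1` A) g x = 0]) => //=.
- by rewrite preimage_setT setIT.
- move=> A mA gA; rewrite -preimage_setC -setDE.
  have mEA : measurable (E `\` f @^-1` A).
    by rewrite setDE preimage_setC; apply: mfS; exact: measurableC.
  have := gE0; rewrite -{1}(setDUK (@subIsetl _ E (f @^-1` A))) setDIr setDv set0U.
  rewrite integral_setU//=.
  + by rewrite gA add0e.
  + exact: mfS.
  + have mg := measurable_int _ ig. by apply: (measurable_funS measurableT _ mg).
  + rewrite disj_set2E; apply/eqP; rewrite setDE setIACA setICr; exact: setI0.
- move=> F mF tF gF; rewrite preimage_bigcup setI_bigcupr integral_bigcup//=.
  + by apply: eseries0 => i _ _; exact: gF.
  + move=> i j _ _ [x [[_ Fi] [_ Fj]]]; apply: tF => //.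
    by exists (f x).
  + by move=> k; exact: mfS.
  + apply: (integrableS measurableT) => //.
    by apply: bigcup_measurable => k _; exact: mfS.
- by rewrite -genG.
Qed.

End dynkin_integral.

(** * Indicators of intervals as limits of exponentials of polynomials *)

Section schwartz_separation.
Variable R : realType.
Local Notation mR := (measurableTypeR R).
Local Notation mR3 := (mR * mR * mR)%type.
Local Notation leb3 := (@leb3 R).

Lemma cvg_mulrn_expn (z : R) : 0 <= z -> z < 1 ->
  (n%:R * z ^+ n) @[n --> \oo] --> (0 : R).
Proof.
move=> z0 z1.
(* Write n z^n = (n s^n) s^n. The first factor is bounded, since (1 - s) n s^n is at most (1 - s)
   times the geometric sum of the s^i for i < n, hence at most 1. *)
pose s := Num.sqrt z.
have s0 : 0 <= s by exact: sqrtr_ge0.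
have s1 : s < 1 by rewrite -sqrtr1 ltr_sqrt.
have bd n : n%:R * s ^+ n <= (1 - s)^-1.
  have : (1 - s) * (n%:R * s ^+ n) <= 1.
    apply: (@le_trans _ _ ((1 - s) * \sum_(i < n) s ^+ i)).
      rewrite ler_pM2l ?subr_gt0// -[X in X%:R]card_ord -sum1_card natr_sum mulr_suml.
      by apply: ler_sum => i _; rewrite mul1r ler_wiXn2l ?(ltW s1)// ltnW.
    by rewrite -opprB mulNr -subrX1 opprB gerDl oppr_le0 exprn_ge0.
  by rewrite -ler_pdivlMl ?subr_gt0// mulr1.
have cs : ((1 - s)^-1 * s ^+ n) @[n --> \oo] --> (0 : R).
  by rewrite -[X in _ --> X](mulr0 (1 - s)^-1); apply: cvgMr; apply: cvg_expr; rewrite ger0_norm.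
apply: (@squeeze_cvgr _ _ _ _ (fun=> 0) (fun n => (1 - s)^-1 * s ^+ n)) => //; last exact: cvg_cst.
near=> n; rewrite mulr_ge0 ?exprn_ge0//=.
by rewrite -[z]sqr_sqrtr// -/s -exprM mulnC muln2 -addnn exprD mulrA ler_wpM2r// exprn_ge0.
Unshelve. all: by end_near. Qed.

(** Nonnegativity keeps x^2 + r_n(x) above x^2, as [rschwartz_tensor3] requires, and e^(-r_n) below
    1, which gives the domination in the limit. *)
Definition indic_approx (I : set R) (r : nat -> {poly R}) : Prop :=
  (forall n x, 0 <= (r n).[x]) /\
  (forall x, expR (- (r n).[x]) @[n --> \oo] --> (\1_I x : R)).

Lemma indic_approxT : indic_approx setT (fun=> 0).
Proof.
split=> [n x|x]; first by rewrite horner0.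
by under eq_fun do rewrite horner0 oppr0 expR0; rewrite indicT; exact: cvg_cst.
Qed.

Lemma expRN_cvg0 (u : nat -> R) : u @ \oo --> +oo ->
  expR (- u n) @[n --> \oo] --> (0 : R).
Proof.
move=> uoo; exact: (cvg_comp u (fun x => expR (- x)) uoo (@cvgr_expR R)).
Qed.

(* On ]c - r, c + r[ the polynomials n (((x - c) / r)^2)^n tend to 0; off this
   open interval, endpoints included, they tend to +oo. *)
Lemma indic_approx_itv (a b : R) : exists r, indic_approx `]a, b[%classic r.
Proof.
have [ab|ba] := ltP a b; last first.
  (* Empty interval: the constants n tend to +oo at every point. *)
  exists (fun n => n%:R%:P); split=> [n x|x]; first by rewrite hornerC.
  rewrite set_itv_ge -?leNgt// indic0.
  under eq_fun do rewrite hornerC.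
  by apply: expRN_cvg0; exact: cvgr_idn.
pose c := (a + b) / 2; pose r := (b - a) / 2.
have r0 : 0 < r by rewrite /r; lra.
pose p : {poly R} := (r^-1 *: ('X - c%:P)) ^+ 2.
have pE x : p.[x] = ((x - c) / r) ^+ 2.
  by rewrite horner_exp hornerZ hornerXsubC mulrC.
exists (fun n => n%:R *: p ^+ n); split=> [n x|x].
  by rewrite hornerZ horner_exp pE mulr_ge0// exprn_ge0// sqr_ge0.
under eq_fun do rewrite hornerZ horner_exp.
have [xab|xab] := boolP (x \in `]a, b[%classic).
  have -> : \1_(`]a, b[%classic : set R) x = expR (- 0) :> R.
    by rewrite indicE xab oppr0 expR0.
  apply: (cvg_comp (fun n => - (n%:R * p.[x] ^+ n)) expR); last exact: continuous_expR.
  apply: cvgN; apply: cvg_mulrn_expn; rewrite pE ?sqr_ge0//.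
  move: xab; rewrite inE /= in_itv/= => /andP[ax xb].
  rewrite -[ltLHS]real_normK ?num_real// expr_lt1// normrM normfV (gtr0_norm r0).
  rewrite ltr_pdivrMr// mul1r ltr_norml.
  by rewrite /c /r; apply/andP; split; lra.
rewrite indicE (negbTE xab); apply: expRN_cvg0.
have p1 : 1 <= p.[x].
  rewrite pE -[leRHS]real_normK ?num_real// expr_ge1//.
  rewrite normrM normfV (gtr0_norm r0) ler_pdivlMr// mul1r.
  move: xab; rewrite notin_setE /= in_itv/= => /negP; rewrite negb_and -!leNgt.
  by move=> /orP[xa|bx]; rewrite ler_normr; apply/orP; [right|left]; rewrite /c /r; lra.
apply: (@ger_cvgy _ _ _ _ (fun n : nat => n%:R)).
  by near=> n; rewrite ler_peMr// exprn_ege1.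
exact: cvgr_idn.
Unshelve. all: by end_near. Qed.

End schwartz_separation.

(** * Functions orthogonal to all real Schwartz functions *)

Section schwartz_separation_thm.
Variable R : realType.
Local Notation mR := (measurableTypeR R).
Local Notation mR3 := (mR * mR * mR)%type.
Local Notation leb3 := (@leb3 R).

Let p1 (x : mR3) : mR := x.1.1.
Let p2 (x : mR3) : mR := x.1.2.
Let p3 (x : mR3) : mR := x.2.

Let mp1 : measurable_fun setT p1.
Proof. exact: (measurableT_comp measurable_fst measurable_fst). Qed.
Let mp2 : measurable_fun setT p2.
Proof. exact: (measurableT_comp measurable_snd measurable_fst). Qed.
Let mp3 : measurable_fun setT p3.
Proof. exact: measurable_snd. Qed.

Lemma measurable_generated_by_itvoo : @measurable _ mR = <<s @RGenOpens.G R >>.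
Proof. exact: RGenOpens.measurableE. Qed.

Lemma setI_closed_itvoo : setI_closed (@RGenOpens.G R).
Proof.
move=> _ _ [a [b ->]] [c [d ->]].
exists (Num.max a c), (Num.min b d); apply/seteqP; split => x /=;
  rewrite !in_itv /= gt_max lt_min.
- by move=> [/andP[-> ->] /andP[-> ->]].
- by move=> /andP[/andP[-> ->] /andP[-> ->]].
Qed.

(** A test function without zeros: it makes h times [gam] integrable on the whole space and can be
    divided out at the end. *)
Let gam : mR3 -> R := tensor3 (fun=> gpoly 'X^2 1).

Let gam_gt0 x : 0 < gam x.
Proof.
by apply: prodr_gt0 => i _; rewrite /gpoly hornerC mul1r expR_gt0.
Qed.

Let coord_proj (x : mR3) (F : 'I_3 -> R -> R) :
  \prod_(i < 3) F i (coord x i) =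
  F ord0 (p1 x) * F (inord 1) (p2 x) * F (inord 2) (p3 x).
Proof.
rewrite !big_ord_recl big_ord0 mulr1 mulrA; congr (_ * F _ _ * F _ _).
- by apply/val_inj; rewrite /= inordK.
- by apply/val_inj; rewrite /= inordK.
Qed.

Section test.
Variable h : mR3 -> R.
Hypothesis h_test : forall phi : R * R * R -> R, rschwartz phi ->
  leb3.-integrable setT (fun x => (h x * phi x)%:E) /\
  (\int[leb3]_x (h x * phi x)%:E = 0)%E.

Let g (x : mR3) := (h x * gam x)%:E.

Let ig : leb3.-integrable setT g.
Proof.
have [] // := h_test (phi := gam); apply: rschwartz_tensor3 => i x.
by rewrite hornerXn.
Qed.

Let mE I1 I2 I3 : measurable (I1 : set mR) -> measurable (I2 : set mR) ->
  measurable (I3 : set mR) ->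
  measurable (p1 @^-1` I1 `&` p2 @^-1` I2 `&` p3 @^-1` I3).
Proof.
move=> m1 m2 m3; apply: measurableI; first apply: measurableI.
- by rewrite -[X in measurable X]setTI; exact: mp1.
- by rewrite -[X in measurable X]setTI; exact: mp2.
- by rewrite -[X in measurable X]setTI; exact: mp3.
Qed.

Let box0 (I1 I2 I3 : set R) r1 r2 r3 :
  measurable (I1 : set mR) -> measurable (I2 : set mR) -> measurable (I3 : set mR) ->
  indic_approx I1 r1 -> indic_approx I2 r2 -> indic_approx I3 r3 ->
  (\int[leb3]_(x in p1 @^-1` I1 `&` p2 @^-1` I2 `&` p3 @^-1` I3) g x = 0)%E.
Proof.
move=> m1 m2 m3 [r10 r1I] [r20 r2I] [r30 r3I].
set E := (X in (\int[_]_(x in X) _)%E).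
have mEE : measurable E by exact: mE.
pose r (n : nat) (i : 'I_3) : {poly R} :=
  tnth [tuple r1 n; r2 n; r3 n] i.
have r0 n i x : 0 <= (r n i).[x].
  by rewrite /r (tnth_nth 0); case: i => [[|[|[|//]]] ?] /=.
pose phi n := tensor3 (fun i => gpoly ('X^2 + r n i) 1).
have phiS n : rschwartz (phi n).
  by apply: rschwartz_tensor3 => i x; rewrite hornerD hornerXn lerDl.
have phiE n x : phi n x = gam x * (expR (- (r1 n).[p1 x]) * expR (- (r2 n).[p2 x])
    * expR (- (r3 n).[p3 x])).
  have -> : phi n x = \prod_(i < 3) (gpoly 'X^2 1 (coord x i) * expR (- (r n i).[coord x i])).
    by apply: eq_bigr => i _; rewrite /gpoly hornerD opprD expRD !mulrA.
  rewrite big_split/= -/(tensor3 _ _) -/(gam x); congr (_ * _).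
  rewrite (coord_proj x (fun i y => expR (- (r n i).[y]))).
  by rewrite /r !(tnth_nth 0) /= !inordK.
pose f_ n (x : mR3) := (h x * phi n x)%:E.
have f0 n : (\int[leb3]_x f_ n x = 0)%E by have [] := h_test (phiS n).
have mf n : measurable_fun setT (f_ n).
  by have [/measurable_int] := h_test (phiS n).
have mg : measurable_fun setT (g \_ E).
  apply/(measurable_restrictT _ mEE).
  exact: measurable_funS measurableT _ (measurable_int _ ig).
rewrite integral_mkcond.
have [] := @dominated_convergence _ _ _ leb3 setT measurableT f_ (g \_ E)
   (fun x => `|g x|%E) mf mg.
- apply: aeW => x _.
  have -> : (g \_ E) x = (h x * (gam x * (\1_I1 (p1 x) * \1_I2 (p2 x) * \1_I3 (p3 x))))%:E.
    rewrite /patch /E !in_setI !indicE.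
    have -> : (x \in p1 @^-1` I1) = (p1 x \in I1) by [].
    have -> : (x \in p2 @^-1` I2) = (p2 x \in I2) by [].
    have -> : (x \in p3 @^-1` I3) = (p3 x \in I3) by [].
    case: (_ \in I1); case: (_ \in I2); case: (_ \in I3) => /=;
      by rewrite ?mulr1 ?mulr0.
  apply/fine_cvgP; split; first by near=> n.
  under eq_fun do rewrite /f_ /= phiE.
  apply: cvgMr; apply: cvgMr; apply: cvgM => //; exact: cvgM.
- exact: integrable_abse.
- apply: aeW => x n _; rewrite lee_fin /= phiE mulrA normrM ler_piMr//.
  rewrite ger0_norm ?mulr_ge0 ?expR_ge0//.
  by rewrite !mulr_ile1 ?mulr_ge0 ?expR_ge0// -expR0 ler_expR oppr_le0.
move=> _ _ /= cf.
have := cvg_lim _ cf; under [X in limn X]eq_fun do rewrite f0.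
by rewrite lim_cst// => <-.
Unshelve. all: by end_near. Qed.

(* Products of e^(-x^2 - r_n(x)), with r_n as in [indic_approx], are test functions
   converging to the indicator of a box times a Gaussian, so h times this
   Gaussian has integral 0 over every box; the boxes form a generating pi-system. *)
Lemma ae0_of_schwartz_orthogonal : measurable_fun setT h ->
  {ae leb3, forall x, h x = 0}.
Proof.
move=> mh.
have mS (A : set mR) f : measurable_fun setT f -> measurable A -> measurable (f @^-1` A : set mR3).
  by move=> mf mA; rewrite -[X in measurable X]setTI; exact: mf.
have mitv (A : set mR) : @RGenOpens.G R A -> measurable A.
  by move=> [a [b ->]]; exact: measurable_itv.
have B (I1 I2 I3 : set mR) : (I1 = setT \/ @RGenOpens.G R I1) ->
    (I2 = setT \/ @RGenOpens.G R I2) -> (I3 = setT \/ @RGenOpens.G R I3) ->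
    (\int[leb3]_(x in p1 @^-1` I1 `&` p2 @^-1` I2 `&` p3 @^-1` I3) g x = 0)%E.
  have H I : (I = setT \/ @RGenOpens.G R I) ->
      measurable (I : set mR) /\ exists r, indic_approx I r.
    move=> [->|[a [b ->]]]; split => //; first by exists (fun=> 0); exact: indic_approxT.
    exact: indic_approx_itv.
  move=> /H[m1 [r1 h1]] /H[m2 [r2 h2]] /H[m3 [r3 h3]]; exact: box0 h1 h2 h3.
(* Intervals are replaced by Borel sets one coordinate at a time, then rectangles by measurable sets
   of the plane, and finally by measurable sets of the space. *)
have B3 (I1 I2 A3 : set mR) : (I1 = setT \/ @RGenOpens.G R I1) ->
    (I2 = setT \/ @RGenOpens.G R I2) -> measurable A3 ->
    (\int[leb3]_(x in p1 @^-1` I1 `&` p2 @^-1` I2 `&` p3 @^-1` A3) g x = 0)%E.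
  move=> h1 h2 mA3.
  apply: (dynkin_integral_eq0 mp3 measurable_generated_by_itvoo setI_closed_itvoo ig) => //.
  - by apply: measurableI; apply: mS => //; [case: h1 => [->//|/mitv]|case: h2 => [->//|/mitv]].
  - by rewrite -[X in (\int[_]_(x in X) _)%E]setIT -(preimage_setT p3); apply: B => //; left.
  - by move=> S GS; apply: B => //; right.
have B2 (I1 A2 A3 : set mR) : (I1 = setT \/ @RGenOpens.G R I1) ->
    measurable A2 -> measurable A3 ->
    (\int[leb3]_(x in p1 @^-1` I1 `&` p2 @^-1` A2 `&` p3 @^-1` A3) g x = 0)%E.
  move=> h1 mA2 mA3; rewrite setIAC.
  apply: (dynkin_integral_eq0 mp2 measurable_generated_by_itvoo setI_closed_itvoo ig) => //.
  - by apply: measurableI; apply: mS => //; case: h1 => [->//|/mitv].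
  - rewrite -[X in (\int[_]_(x in X) _)%E]setIT -(preimage_setT p2) setIAC.
    by apply: B3 => //; left.
  - by move=> S GS; rewrite setIAC; apply: B3 => //; right.
have B1 (A1 A2 A3 : set mR) : measurable A1 -> measurable A2 -> measurable A3 ->
    (\int[leb3]_(x in p1 @^-1` A1 `&` p2 @^-1` A2 `&` p3 @^-1` A3) g x = 0)%E.
  move=> mA1 mA2 mA3; rewrite -setIA setIC.
  apply: (dynkin_integral_eq0 mp1 measurable_generated_by_itvoo setI_closed_itvoo ig) => //.
  - by apply: measurableI; apply: mS.
  - by rewrite -[X in (\int[_]_(x in X) _)%E]setTI -(preimage_setT p1) setIA; apply: B2 => //; left.
  - by move=> S GS; rewrite setIC setIA; apply: B2 => //; right.
have rectI d1 d2 (T1 : measurableType d1) (T2 : measurableType d2) :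
    setI_closed [set A `*` B | A in @measurable _ T1 & B in @measurable _ T2].
  move=> _ _ [A mA [B' mB <-]] [A' mA' [B'' mB' <-]].
  rewrite -setXI; exists (A `&` A'); first exact: measurableI.
  by exists (B' `&` B'') => //; exact: measurableI.
have B12 (A12 : set (mR * mR)%type) (A3 : set mR) : measurable A12 -> measurable A3 ->
    (\int[leb3]_(x in p3 @^-1` A3 `&` fst @^-1` A12) g x = 0)%E.
  move=> mA12 mA3.
  apply: (dynkin_integral_eq0 measurable_fst (measurable_prod_measurableType _ _)
    (@rectI _ _ _ _) ig) => //.
  - exact: mS.
  - by rewrite -[X in (\int[_]_(x in X) _)%E]setTI -[X in X `&` _]setTI
      -{1}(preimage_setT p1) -(preimage_setT p2); apply: B1.
  - move=> _ [A mA [A' mA' <-]]; rewrite setIC.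
    exact: (B1 A A' A3).
have : ae_eq leb3 setT g (cst 0%E).
  apply: integral_ae_eq => // E _ mE'; rewrite integral0.
  rewrite -[X in (\int[_]_(x in X) _)%E]setTI -[X in _ `&` X]preimage_id.
  apply: (dynkin_integral_eq0 (@measurable_id _ _ _)
    (measurable_prod_measurableType _ _) (@rectI _ _ _ _) ig) => //.
    rewrite -[X in (\int[_]_(x in X) _)%E]setTI -{1}(preimage_setT p3) -(preimage_setT fst).
    exact: B12.
  move=> _ [A12 mA12 [A3 mA3 <-]]; rewrite setTI preimage_id.
  have -> : A12 `*` A3 = p3 @^-1` A3 `&` fst @^-1` A12 by rewrite setIC.
  exact: B12.
apply: filterS => x /(_ I) /= [] /eqP; rewrite mulf_eq0 => /orP[/eqP//|].
by rewrite gt_eqF.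
Qed.

End test.
End schwartz_separation_thm.

(** * Complex vectors and integrals *)

Section cnorm_theory.
Variable R : realType.
Local Notation C3 := ('I_3 -> R[i]).
Implicit Types (z : R[i]) (v w : C3).

(** The inner product of C^3 seen as R^6, that is the real part of the Hermitian product. *)
Definition rdot v w : R :=
  \sum_(j < 3) (complex.Re (v j) * complex.Re (w j) + complex.Im (v j) * complex.Im (w j)).

Lemma normc_sqr z : normc z ^+ 2 = complex.Re z ^+ 2 + complex.Im z ^+ 2.
Proof. by case: z => a b /=; rewrite sqr_sqrtr// addr_ge0// sqr_ge0. Qed.

Lemma normc_ge0 z : 0 <= normc z.
Proof. by case: z => a b; exact: sqrtr_ge0. Qed.

Lemma cnorm_ge0 w : 0 <= cnorm w.
Proof. exact: sqrtr_ge0. Qed.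

Lemma cnorm_sqr w : cnorm w ^+ 2 = rdot w w.
Proof.
rewrite sqr_sqrtr; last by apply: sumr_ge0 => j _; rewrite sqr_ge0.
by apply: eq_bigr => j _; rewrite normc_sqr -!expr2.
Qed.

Lemma Re_le_normc z : `|complex.Re z| <= normc z.
Proof.
rewrite -(ler_pXn2r (n := 2))// ?nnegrE ?normc_ge0//.
by rewrite normc_sqr real_normK ?num_real// lerDl sqr_ge0.
Qed.

Lemma Im_le_normc z : `|complex.Im z| <= normc z.
Proof.
rewrite -(ler_pXn2r (n := 2))// ?nnegrE ?normc_ge0//.
by rewrite normc_sqr real_normK ?num_real// lerDr sqr_ge0.
Qed.

Lemma normc_le_cnorm w j : normc (w j) <= cnorm w.
Proof.
rewrite -(ler_pXn2r (n := 2))// ?nnegrE ?normc_ge0 ?cnorm_ge0//.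
rewrite sqr_sqrtr; last by apply: sumr_ge0 => i _; rewrite sqr_ge0.
by rewrite (bigD1 j)//= lerDl sumr_ge0// => i _; rewrite sqr_ge0.
Qed.

Lemma cnorm_le_sum w : cnorm w <= \sum_(j < 3) normc (w j).
Proof.
rewrite -(ler_pXn2r (n := 2))// ?nnegrE ?cnorm_ge0 ?sumr_ge0//; last first.
  by move=> i _; exact: normc_ge0.
rewrite sqr_sqrtr; last by apply: sumr_ge0 => i _; rewrite sqr_ge0.
rewrite !big_ord_recl !big_ord0 !addr0.
have := normc_ge0 (w ord0); have := normc_ge0 (w (lift ord0 ord0)).
have := normc_ge0 (w (lift ord0 (lift ord0 ord0))).
move: (normc _) (normc _) (normc _) => a b c a0 b0 c0; nra.
Qed.

Lemma rdot_linearr w v1 v2 (a b : R) (u : C3) :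
  (forall j, u j = a%:C * v1 j + b%:C * v2 j)%C ->
  rdot w u = a * rdot w v1 + b * rdot w v2.
Proof.
move=> uE; rewrite /rdot !mulr_sumr -big_split/=; apply: eq_bigr => j _.
rewrite uE; case: (v1 j) (v2 j) (w j) => [x1 y1] [x2 y2] [x y] /=; ring.
Qed.

Lemma rdotC v w : rdot v w = rdot w v.
Proof. by apply: eq_bigr => j _; rewrite mulrC [X in _ + X]mulrC. Qed.

Lemma rdot_le v w : rdot v w <= cnorm v * cnorm w.
Proof.
set s := cnorm v; set t := cnorm w.
have s0 : 0 <= s by exact: cnorm_ge0.
have t0 : 0 <= t by exact: cnorm_ge0.
have Z (v' w' : C3) : cnorm v' = 0 -> rdot v' w' = 0.
  move=> v0; apply: big1 => j _.
  have : normc (v' j) = 0 by apply/eqP; rewrite eq_le normc_ge0 -v0 normc_le_cnorm.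
  move=> nz; move: (Re_le_normc (v' j)) (Im_le_normc (v' j)).
  by rewrite nz !normr_le0 => /eqP -> /eqP ->; rewrite !mul0r addr0.
have [st0|st0] := eqVneq (s * t) 0.
  move/eqP: (st0); rewrite mulf_eq0 => /orP[] /eqP z0; first by rewrite Z// z0 mul0r.
  by rewrite rdotC Z// z0 mulr0.
have stp : 0 < s * t by rewrite lt_neqAle eq_sym st0 mulr_ge0.
(* With s = |v| and t = |w|, expanding |t v - s w|^2 >= 0 gives 2 s t (s t - <v, w>) >= 0. *)
pose u : C3 := fun j => (t%:C * v j + (- s)%:C * w j)%C.
have : 0 <= rdot u u by rewrite -cnorm_sqr sqr_ge0.
rewrite (@rdot_linearr u v w t (- s) u)// (rdotC u v) (rdotC u w).
rewrite (@rdot_linearr v v w t (- s) u)// (@rdot_linearr w v w t (- s) u)//.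
rewrite (rdotC w v) -!cnorm_sqr -/s -/t => H.
have : 0 <= (s * t) * (s * t - rdot v w) by move: H; lra.
by rewrite pmulr_rge0// subr_ge0.
Qed.

Lemma cnormD v w : cnorm (fun j => v j + w j) <= cnorm v + cnorm w.
Proof.
rewrite -(ler_pXn2r (n := 2))// ?nnegrE ?addr_ge0 ?cnorm_ge0//.
rewrite cnorm_sqr (@rdot_linearr _ v w 1 1); last by move=> j; rewrite !mul1r.
rewrite (rdotC _ v) (rdotC _ w) (@rdot_linearr v v w 1 1); last by move=> j; rewrite !mul1r.
rewrite (@rdot_linearr w v w 1 1); last by move=> j; rewrite !mul1r.
rewrite (rdotC w v) -!cnorm_sqr.
by have := rdot_le v w; lra.
Qed.

Lemma cnorm_scale (a : R) v : 0 <= a -> cnorm (fun j => a%:C * v j)%C = a * cnorm v.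
Proof.
move=> a0; apply/eqP; rewrite -(eqrXn2 (n := 2))// ?mulr_ge0 ?cnorm_ge0//.
rewrite exprMn !cnorm_sqr (@rdot_linearr _ v v a 0); last first.
  by move=> j; rewrite mul0r addr0.
rewrite (rdotC _ v) (@rdot_linearr v v v a 0); last first.
  by move=> j; rewrite mul0r addr0.
by apply/eqP; ring.
Qed.

Lemma cnormN v : cnorm (fun j => - v j) = cnorm v.
Proof.
congr Num.sqrt; apply: eq_bigr => j _; rewrite !normc_sqr.
by case: (v j) => x y /=; rewrite !sqrrN.
Qed.

Lemma cnormB v w : cnorm (fun j => v j - w j) <= cnorm v + cnorm w.
Proof. by rewrite -(cnormN w); exact: cnormD. Qed.

End cnorm_theory.

(** * Measurability and integration of complex functions *)

Section cint_theory.
Context (d : measure_display) (T : measurableType d) (R : realType).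
Variables (mu : {measure set T -> \bar R}) (D : set T).
Hypothesis mD : measurable D.
Implicit Types f g : T -> R[i].

Lemma ReB (z w : R[i]) : complex.Re (z - w) = complex.Re z - complex.Re w.
Proof. by case: z w => ? ? [? ?]. Qed.
Lemma ImB (z w : R[i]) : complex.Im (z - w) = complex.Im z - complex.Im w.
Proof. by case: z w => ? ? [? ?]. Qed.
Lemma ReD (z w : R[i]) : complex.Re (z + w) = complex.Re z + complex.Re w.
Proof. by case: z w => ? ? [? ?]. Qed.
Lemma ImD (z w : R[i]) : complex.Im (z + w) = complex.Im z + complex.Im w.
Proof. by case: z w => ? ? [? ?]. Qed.
Lemma ReM (z w : R[i]) :
  complex.Re (z * w) = complex.Re z * complex.Re w - complex.Im z * complex.Im w.
Proof. by case: z w => ? ? [? ?]. Qed.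
Lemma ImM (z w : R[i]) :
  complex.Im (z * w) = complex.Re z * complex.Im w + complex.Im z * complex.Re w.
Proof. by case: z w => ? ? [? ?]. Qed.

Lemma complexP (z w : R[i]) :
  complex.Re z = complex.Re w -> complex.Im z = complex.Im w -> z = w.
Proof. by case: z w => ? ? [? ?] /= -> ->. Qed.

Lemma cmeasurableB f g : cmeasurable D f -> cmeasurable D g ->
  cmeasurable D (fun x => f x - g x).
Proof.
move=> [f1 f2] [g1 g2]; split.
- by under eq_fun do rewrite ReB; exact: measurable_funB.
- by under eq_fun do rewrite ImB; exact: measurable_funB.
Qed.

Lemma cmeasurableD f g : cmeasurable D f -> cmeasurable D g ->
  cmeasurable D (fun x => f x + g x).
Proof.
move=> [f1 f2] [g1 g2]; split.
- by under eq_fun do rewrite ReD; exact: measurable_funD.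
- by under eq_fun do rewrite ImD; exact: measurable_funD.
Qed.

Lemma cmeasurableM f g : cmeasurable D f -> cmeasurable D g ->
  cmeasurable D (fun x => f x * g x).
Proof.
move=> [f1 f2] [g1 g2]; split.
- under eq_fun do rewrite ReM.
  by apply: measurable_funB; exact: measurable_funM.
- under eq_fun do rewrite ImM.
  by apply: measurable_funD; exact: measurable_funM.
Qed.

Lemma cmeasurable_sum n (F : 'I_n -> T -> R[i]) :
  (forall i, cmeasurable D (F i)) -> cmeasurable D (fun x => \sum_(i < n) F i x).
Proof.
move=> mF; have : forall s, cmeasurable D (fun x => \sum_(i <- s) F i x).
  elim=> [|i s IH].
    by split; under eq_fun do rewrite big_nil; exact: measurable_cst.
  by under eq_fun do rewrite big_cons; exact: cmeasurableD.
by apply.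
Qed.

Lemma cintegrableB f g : cintegrable mu D f -> cintegrable mu D g ->
  cintegrable mu D (fun x => f x - g x).
Proof.
move=> [f1 f2] [g1 g2]; split.
- by under eq_fun do rewrite ReB EFinB; exact: integrableB.
- by under eq_fun do rewrite ImB EFinB; exact: integrableB.
Qed.

Lemma cintB f g : cintegrable mu D f -> cintegrable mu D g ->
  cint mu D (fun x => f x - g x) = cint mu D f - cint mu D g.
Proof.
move=> [f1 f2] [g1 g2]; apply: complexP.
- by rewrite ReB /= -RintegralB//; apply: eq_Rintegral => x _; rewrite ReB.
- by rewrite ImB /= -RintegralB//; apply: eq_Rintegral => x _; rewrite ImB.
Qed.

Lemma cintD f g : cintegrable mu D f -> cintegrable mu D g ->
  cint mu D (fun x => f x + g x) = cint mu D f + cint mu D g.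
Proof.
move=> [f1 f2] [g1 g2]; apply: complexP.
- by rewrite ReD /= -RintegralD//; apply: eq_Rintegral => x _; rewrite ReD.
- by rewrite ImD /= -RintegralD//; apply: eq_Rintegral => x _; rewrite ImD.
Qed.

Lemma ae_eq_cint f g : cmeasurable D f -> cmeasurable D g ->
  {ae mu, forall x, D x -> f x = g x} -> cint mu D f = cint mu D g.
Proof.
move=> [f1 f2] [g1 g2] fg; apply: complexP; rewrite /= /Rintegral; congr fine;
  apply: ae_eq_integral => //; try exact/measurable_EFinP;
  by apply: filterS fg => x /[apply] /= ->.
Qed.

Lemma integrableZl_EFin (r : R) (h : T -> R) : mu.-integrable D (EFin \o h) ->
  mu.-integrable D (EFin \o (fun x => r * h x)).
Proof.
move=> ih; have -> : EFin \o (fun x => r * h x) = (fun x => r%:E * (EFin \o h) x)%E.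
  by apply/funext => x; rewrite /= EFinM.
exact: integrableZl.
Qed.

Lemma integrableD_EFin (h1 h2 : T -> R) : mu.-integrable D (EFin \o h1) ->
  mu.-integrable D (EFin \o h2) -> mu.-integrable D (EFin \o (fun x => h1 x + h2 x)).
Proof.
move=> i1 i2.
have -> : EFin \o (fun x => h1 x + h2 x) = (fun x => (EFin \o h1) x + (EFin \o h2) x)%E.
  by apply/funext => x; rewrite /= EFinD.
exact: integrableD.
Qed.

Lemma cintegrable_le f (b : T -> R) : cmeasurable D f ->
  mu.-integrable D (EFin \o b) -> {ae mu, forall x, D x -> normc (f x) <= b x} ->
  cintegrable mu D f.
Proof.
move=> [f1 f2] ib fb.
have H (p : R[i] -> R) : measurable_fun D (fun x => p (f x)) ->
    (forall z, `|p z| <= normc z) -> mu.-integrable D (fun x => (p (f x))%:E).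
  move=> mp pn; apply/integrableP; split; first exact/measurable_EFinP.
  have /integrableP[mb ib'] := ib.
  apply: le_lt_trans ib'; apply: ae_ge0_le_integral => //.
  - by apply: measurableT_comp => //; exact/measurable_EFinP.
  - exact: measurableT_comp.
  - apply: filterS fb => x fb Dx /=; rewrite lee_fin.
    by apply: (le_trans (pn _)); apply: (le_trans (fb Dx)); exact: ler_norm.
by split; apply: H => //; [exact: Re_le_normc|exact: Im_le_normc].
Qed.

End cint_theory.

(** * Uniqueness of the Fourier transform *)

Section hat_unique.
Variable R : realType.
Local Notation mR := (measurableTypeR R).
Local Notation mR3 := (mR * mR * mR)%type.
Local Notation R3 := (R * R * R)%type.
Local Notation leb3 := (@leb3 R).
Implicit Types (T S : functional R) (u v : vdist R).

#[global] Instance lebesgue_ae_filter :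
  Filter (nbhs (almost_everywhere (@lebesgue_measure R))).
Proof. exact: ae_filter_ringOfSetsType. Qed.

#[global] Instance leb3_ae_filter : Filter (nbhs (almost_everywhere (@Defs.leb3 R))).
Proof. exact: ae_filter_ringOfSetsType. Qed.

Lemma measurable_coord j : measurable_fun (setT : set mR3) (fun x => coord x j : mR).
Proof.
case: j => [[|[|[|//]]] ?]; rewrite /coord; under eq_fun do rewrite (tnth_nth 0) /=.
- exact: (measurableT_comp measurable_fst measurable_fst).
- exact: (measurableT_comp measurable_snd measurable_fst).
- exact: measurable_snd.
Qed.

Lemma measurable_dot_self : measurable_fun (setT : set mR3) (fun x => dot x x).
Proof.
by apply: measurable_sum => j; apply: measurable_funM; exact: measurable_coord.
Qed.

Lemma measurable_enorm : measurable_fun (setT : set mR3) (@enorm R).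
Proof.
apply: (measurableT_comp (f := @Num.sqrt R)); last exact: measurable_dot_self.
by apply: continuous_measurable_fun; exact: sqrt_continuous.
Qed.

Lemma measurable_ball3 (r : R) : measurable ([set xi | enorm xi <= r] : set mR3).
Proof.
have -> : [set xi : mR3 | enorm xi <= r] = setT `&` @enorm R @^-1` `]-oo, r].
  by apply/seteqP; split => xi /=; rewrite in_itv/= => // -[].
exact: measurable_enorm.
Qed.

Lemma schwartz_real (phi : R3 -> R) : rschwartz phi ->
  schwartz (fun x => (phi x)%:C)%C.
Proof.
move=> sphi; split => //=.
have -> : (fun=> 0) = tensor3 (fun=> gpoly 'X^2 (0 : {poly R})).
  apply/funext => x; rewrite /tensor3 big_ord_recl /gpoly horner0.
  by rewrite !mul0r.
by apply: rschwartz_tensor3 => i x; rewrite hornerXn.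
Qed.

Lemma fourier_rep_unique T (f g : R3 -> R[i]) :
  fourier_rep T f -> fourier_rep T g -> {ae leb3, forall x, f x = g x}.
Proof.
move=> [mf _ Tf] [mg _ Tg].
(* [p] stands for the real or the imaginary part; since the test function is real, pairing with it
   commutes with [p]. *)
have H (p : R[i] -> R) : (forall z w, p (z - w) = p z - p w) ->
    (forall z a, p (z * a%:C)%C = p z * a) ->
    (forall h, cmeasurable (setT : set mR3) h -> measurable_fun setT (p \o h)) ->
    (forall h, cintegrable leb3 setT h -> leb3.-integrable setT (EFin \o (p \o h))) ->
    (forall h, p (cint leb3 setT h) = Rintegral leb3 setT (p \o h)) ->
    {ae leb3, forall x, p (f x) - p (g x) = 0}.
  move=> pB pM mp ip Ip.
  apply: (@ae0_of_schwartz_orthogonal _ (fun x => p (f x) - p (g x))); last first.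
    by apply: measurable_funB; exact: mp.
  move=> phi sphi; have sc := schwartz_real sphi.
  have [if_ Tf'] := Tf _ sc; have [ig_ Tg'] := Tg _ sc.
  have E h : p \o (fun xi => h xi * (phi xi)%:C)%C = (fun xi => p (h xi) * phi xi).
    by apply/funext => xi /=; rewrite pM.
  have i1 := ip _ if_; have i2 := ip _ ig_; rewrite E in i1; rewrite E in i2.
  have fE : (fun x => ((p (f x) - p (g x)) * phi x)%:E) =
    (fun x => (p (f x) * phi x)%:E - (p (g x) * phi x)%:E)%E.
    by apply/funext => x; rewrite mulrBl EFinB.
  rewrite fE; split; first exact: integrableB.
  rewrite integralB//.
  have := f_equal p (etrans (esym Tf') Tg'); rewrite !Ip !E /Rintegral => Ef.
  have f1 := integrable_fin_num measurableT i1.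
  have f2 := integrable_fin_num measurableT i2.
  by rewrite -(fineK f1) -(fineK f2) /= -EFinB Ef subrr.
have Hr : {ae leb3, forall x, complex.Re (f x) - complex.Re (g x) = 0}.
  apply: (H (@complex.Re R)) => //.
  - exact: ReB.
  - by move=> z a; rewrite ReM /= mulr0 subr0.
  - by move=> h [].
  - by move=> h [].
have Hi : {ae leb3, forall x, complex.Im (f x) - complex.Im (g x) = 0}.
  apply: (H (@complex.Im R)) => //.
  - exact: ImB.
  - by move=> z a; rewrite ImM /= mulr0 add0r.
  - by move=> h [].
  - by move=> h [].
apply: filterS2 Hr Hi => x /eqP; rewrite subr_eq0 => /eqP rE /eqP; rewrite subr_eq0 => /eqP iE.
exact: complexP.
Qed.

Lemma vfourier_rep_unique v (f g : R3 -> 'I_3 -> R[i]) :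
  vfourier_rep v f -> vfourier_rep v g -> {ae leb3, forall x, f x = g x}.
Proof.
move=> vf vg.
have : {ae leb3, forall x, forall j, f x j = g x j}.
  by apply: filter_forall => j; exact: fourier_rep_unique (vf j) (vg j).
by apply: filterS => x fg; apply/funext.
Qed.

Lemma vfourier_rep_hat a v : PM a v -> vfourier_rep v (hat v).
Proof. by move=> [_ [f vf] _]; exact: (xgetPex (fun _ _ => 0) (ex_intro _ f vf)). Qed.

Lemma fourier_repB T S (f g : R3 -> R[i]) :
  fourier_rep T f -> fourier_rep S g -> fourier_rep (T - S) (fun x => f x - g x).
Proof.
move=> [mf lf Tf] [mg lg Sg]; split.
- exact: cmeasurableB.
- by move=> r; apply: cintegrableB => //; exact: measurable_ball3.
- move=> phi sphi; have [i1 E1] := Tf _ sphi; have [i2 E2] := Sg _ sphi.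
  have -> : (fun xi => (f xi - g xi) * phi xi) = (fun xi => f xi * phi xi - g xi * phi xi).
    by apply/funext => xi; rewrite mulrBl.
  split; first exact: cintegrableB.
  by rewrite cintB// -E1 -E2.
Qed.

Lemma temperedB T S : tempered T -> tempered S -> tempered (T - S).
Proof.
move=> [Tl [N [A TA]]] [Sl [N' [A' SA]]]; split.
  move=> a phi psi sphi spsi; rewrite !fctE Tl// Sl//; ring.
exists (maxn N N'), (A + A') => phi M sphi phiM.
rewrite !fctE mulrDl.
apply: (@le_trans _ _ (normc (T phi) + normc (S phi))).
  by rewrite -(normcN (S phi)); exact: le_normcD.
apply: lerD.
- apply: TA => // k s x kN sN; apply: phiM.
    exact: leq_trans kN (leq_maxl _ _).
  exact: leq_trans sN (leq_maxl _ _).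
- apply: SA => // k s x kN sN; apply: phiM.
    exact: leq_trans kN (leq_maxr _ _).
  exact: leq_trans sN (leq_maxr _ _).
Qed.

Lemma hatnorm_leP a (f : R3 -> 'I_3 -> R[i]) (M : \bar R) :
  (hatnorm a f <= M)%E <->
  {ae leb3, forall xi, ((enorm xi `^ a * cnorm (f xi))%:E <= M)%E}.
Proof. by split => /ess_supP. Qed.

(** Needed for norms to be nonnegative: over a space of measure 0 the essential supremum would be
    -oo. *)
Lemma leb3T_gt0 : (0 < @Defs.leb3 R setT)%E.
Proof.
apply: (@lt_le_trans _ _ (@Defs.leb3 R ((`]0, 1] `*` `]0, 1]) `*` `]0, 1]))).
  rewrite /Defs.leb3 product_measure1E//=; last exact: measurableX.
  rewrite /leb2 product_measure1E//= !lebesgue_measure_itv/= lte_fin ltr01.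
  by rewrite sube0 !mule1 lte_fin.
by apply: le_measure => //; rewrite inE//=; apply: measurableX => //; exact: measurableX.
Qed.

Lemma hatnorm_ge0 a (f : R3 -> 'I_3 -> R[i]) : (0 <= hatnorm a f)%E.
Proof.
apply: ess_sup_gee; first exact: leb3T_gt0.
by apply: aeW => x; rewrite lee_fin mulr_ge0 ?powR_ge0// cnorm_ge0.
Qed.

Lemma hatnormD_le a (f g h : R3 -> 'I_3 -> R[i]) :
  {ae leb3, forall xi, cnorm (h xi) <= cnorm (f xi) + cnorm (g xi)} ->
  (hatnorm a h <= hatnorm a f + hatnorm a g)%E.
Proof.
move=> hfg; apply/hatnorm_leP.
have /hatnorm_leP Hf := lexx (hatnorm a f).
have /hatnorm_leP Hg := lexx (hatnorm a g).
apply: filterS3 hfg Hf Hg => xi hfg Hf Hg.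
apply: le_trans (leeD Hf Hg); rewrite -EFinD lee_fin -mulrDr.
by rewrite ler_wpM2l// powR_ge0.
Qed.

Section PM_sub.
Variables (a b : R) (u v : vdist R).
Hypotheses (Pu : PM a u) (Pv : PM b v).

Lemma vfourier_repB :
  vfourier_rep (u - v) (fun xi j => hat u xi j - hat v xi j).
Proof.
by move=> j; apply: fourier_repB; [exact: vfourier_rep_hat Pu j|exact: vfourier_rep_hat Pv j].
Qed.

(** [hat] chooses a representative and so is not linear pointwise; uniqueness makes it linear up to
    null sets. *)
Lemma hatB : {ae leb3, forall xi, hat (u - v) xi = (fun j => hat u xi j - hat v xi j)}.
Proof.
apply: vfourier_rep_unique vfourier_repB.
exact: (xgetPex (fun _ _ => 0) (ex_intro _ _ vfourier_repB)).
Qed.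

End PM_sub.

Lemma PMB a u v : PM a u -> PM a v -> PM a (u - v).
Proof.
move=> Pu Pv; split.
- by move=> j; apply: temperedB; [case: Pu|case: Pv].
- by eexists; exact: (vfourier_repB Pu Pv).
- apply: (@le_lt_trans _ _ (PMnorm a u + PMnorm a v)%E); last first.
    by rewrite lte_add_pinfty//; [case: Pu|case: Pv].
  apply: hatnormD_le; apply: filterS (hatB Pu Pv) => xi ->.
  exact: cnormB.
Qed.

End hat_unique.

(** * Null sets in products and under reflections *)

Section measure_preserving.
Local Open Scope ereal_scope.
Context d1 d2 (T1 : measurableType d1) (T2 : measurableType d2) (R : realType).
Variables (m1 : {sigma_finite_measure set T1 -> \bar R})
          (m2 : {sigma_finite_measure set T2 -> \bar R}).

(** The image of the product measure agrees with it on rectangles, and these determine it. *)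
Lemma prod_measure_preserving (f1 : T1 -> T1) (f2 : T2 -> T2) :
  measurable_fun setT f1 -> measurable_fun setT f2 ->
  (forall A, measurable A -> m1 (f1 @^-1` A) = m1 A) ->
  (forall A, measurable A -> m2 (f2 @^-1` A) = m2 A) ->
  forall A, measurable A -> (m1 \x m2) ((fun p => (f1 p.1, f2 p.2)) @^-1` A) = (m1 \x m2) A.
Proof.
move=> mf1 mf2 f1E f2E A mA.
pose g (p : T1 * T2) := (f1 p.1, f2 p.2).
have mf : measurable_fun setT g.
  by apply: measurable_fun_pair; apply: measurableT_comp.
pose mix := isMeasurableFun.Build _ _ _ _ _ mf.
pose f : {mfun (T1 * T2)%type >-> (T1 * T2)%type} := HB.pack g mix.
have -> : (m1 \x m2) A = pushforward (m1 \x m2) f A; last by [].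
apply: product_measure_unique => // B C mB mC; rewrite /pushforward /=.
rewrite -[LHS]/((m1 \x m2) ((f1 @^-1` B) `*` (f2 @^-1` C))).
have mB' : measurable (f1 @^-1` B) by rewrite -[X in measurable X]setTI; exact: mf1.
have mC' : measurable (f2 @^-1` C) by rewrite -[X in measurable X]setTI; exact: mf2.
by rewrite product_measure1E// -(f1E _ mB) -(f2E _ mC).
Qed.

Lemma null_sections_swap (A : set (T1 * T2)) : measurable A ->
  (forall x, m2 (xsection A x) = 0) -> {ae m2, forall y, m1 (ysection A y) = 0}.
Proof.
move=> mA A0.
have := indic_fubini_tonelli m1 m2 mA.
rewrite (_ : (\int[m1]_x _) = 0) => [/esym H|]; last first.
  apply: integral0_eq => x _.
  by have /(congr1 (fun h => h x)) /= := indic_fubini_tonelli_FE m2 mA; rewrite A0.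
have := @ae_eq_integral_abs _ _ _ m2 setT measurableT (m1 \o ysection A) _.
have mY : measurable_fun setT (m1 \o ysection A) by exact: measurable_fun_ysection.
move=> /(_ mY)[+ _]; move=> H'.
have : \int[m2]_y `|(m1 \o ysection A) y| = 0.
  rewrite -[RHS]H; apply: eq_integral => y _.
  have /(congr1 (fun h => h y)) /= -> := indic_fubini_tonelli_GE m1 mA.
  by rewrite gee0_abs.
by move/H'; apply: filterS => y /(_ I).
Qed.

(** With T1 the time axis and T2 the frequency space, this passes from facts at each time to facts
    at a fixed frequency, by Tonelli applied to the complement of [A]. *)
Lemma ae_swap (A : set (T1 * T2)) : measurable A ->
  (forall x, {ae m2, forall y, A (x, y)}) ->
  {ae m2, forall y, {ae m1, forall x, A (x, y)}}.
Proof.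
move=> mA hA.
have mAC : measurable (~` A) by exact: measurableC.
have := @null_sections_swap (~` A) mAC.
have H x : m2 (xsection (~` A) x) = 0.
  have [N [mN N0 sub]] := hA x.
  apply/eqP; rewrite eq_le measure_ge0 andbT -N0 le_measure// ?inE//.
    exact: measurable_xsection.
  by move=> y; rewrite /xsection /= inE => Axy; apply: sub.
move=> /(_ H); apply: filterS => y Ay.
exists (ysection (~` A) y); split => //; first exact: measurable_ysection.
by move=> x /= Axy; rewrite /ysection /= inE.
Qed.

End measure_preserving.

(** * Invariance of Lebesgue measure under y -> xi - y, and coordinate planes *)

Section reflection.
Variable R : realType.
Local Notation mR := (measurableTypeR R).
Local Notation mR3 := (mR * mR * mR)%type.
Local Notation R3 := (R * R * R)%type.
Local Notation leb1 := (@lebesgue_measure R).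
Local Notation leb3 := (@leb3 R).

Let refl (c : R) : mR -> mR := fun y => c - y.

Lemma measurable_refl c : measurable_fun setT (refl c).
Proof. exact: measurable_funB. Qed.

Lemma lebesgue_measure_refl (c : R) (A : set mR) : measurable A ->
  leb1 (refl c @^-1` A) = leb1 A.
Proof.
move=> mA; pose mix := isMeasurableFun.Build _ _ _ _ _ (measurable_refl c).
pose f : {mfun mR >-> mR} := HB.pack (refl c) mix.
have -> : leb1 A = pushforward leb1 f A; last by [].
apply: lebesgue_measure_unique => // X [[a b] _ <-] /=.
have -> : pushforward leb1 f `]a, b]%classic = leb1 `[c - b, c - a[%classic.
  congr (leb1 _); apply/seteqP; split => y; rewrite /preimage /= !in_itv /= /f /= /refl.
    by move=> /andP[? ?]; apply/andP; split; lra.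
  by move=> /andP[? ?]; apply/andP; split; lra.
rewrite !lebesgue_measure_itv /= !lte_fin ltrD2l ltrN2.
by case: ifP => // _; rewrite -!EFinB; congr (_%:E); ring.
Qed.

Lemma lebesgue_integral_refl (c : R) (f : mR -> \bar R) :
  measurable_fun setT f -> (forall y, 0 <= f y)%E ->
  (\int[leb1]_y f (c - y)%R = \int[leb1]_y f y)%E.
Proof.
move=> mf f0.
have := @ge0_integral_pushforward _ _ _ _ _ _ (measurable_refl c) leb1 setT f
  measurableT mf.
rewrite preimage_setT => <-; last by move=> y _; exact: f0.
apply: eq_measure_integral; first exact: measurable_refl.
by move=> ? A mA _; exact: lebesgue_measure_refl.
Qed.

Let refl3 (xi : R3) : mR3 -> mR3 := fun y => xi - y.

Lemma measurable_refl3 xi : measurable_fun setT (refl3 xi).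
Proof.
apply: measurable_fun_pair.
  apply: measurable_fun_pair.
    apply: (measurableT_comp (measurable_refl xi.1.1)).
    exact: (measurableT_comp measurable_fst measurable_fst).
  apply: (measurableT_comp (measurable_refl xi.1.2)).
  exact: (measurableT_comp measurable_snd measurable_fst).
exact: (measurableT_comp (measurable_refl xi.2) measurable_snd).
Qed.

Lemma leb3_refl (xi : R3) (A : set mR3) : measurable A ->
  leb3 (refl3 xi @^-1` A) = leb3 A.
Proof.
have m2 (B : set (mR * mR)%type) : measurable B ->
    leb2 ((fun p => (refl xi.1.1 p.1, refl xi.1.2 p.2)) @^-1` B) = leb2 B.
  apply: prod_measure_preserving; first [exact: measurable_refl|exact: lebesgue_measure_refl].
apply: (prod_measure_preserving (m1 := @leb2 R)
  (f1 := fun p => (refl xi.1.1 p.1, refl xi.1.2 p.2)) (f2 := refl xi.2)) => //.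
- apply: measurable_fun_pair.
    by apply: (measurableT_comp (measurable_refl _)).
  by apply: (measurableT_comp (measurable_refl _)).
- exact: measurable_refl.
- exact: lebesgue_measure_refl.
Qed.

Lemma ae_leb3_refl (xi : R3) (P : R3 -> Prop) :
  {ae leb3, forall y, P y} -> {ae leb3, forall y, P (xi - y)}.
Proof.
move=> [N [mN N0 sub]]; exists (refl3 xi @^-1` N); split.
- by rewrite -[X in measurable X]setTI; exact: measurable_refl3.
- by rewrite leb3_refl.
- by move=> y; exact: sub.
Qed.

Lemma ae_coord_neq (c : R) (j : 'I_3) : {ae leb3, forall y, coord y j != c}.
Proof.
have l0 : leb1 [set c] = 0%E by exact: lebesgue_measure_set1.
case: j => [[|[|[|//]]] ?].
- exists (([set c] `*` setT) `*` setT); split.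
  + by apply: measurableX => //; exact: measurableX.
  + rewrite [LHS]product_measure1E//=; last exact: measurableX.
    by rewrite /leb2 product_measure1E// [X in (X * _ * _)%E]l0 !mul0e.
  + by move=> y /= /negP/negPn; rewrite /coord (tnth_nth 0) /= => /eqP.
- exists ((setT `*` [set c]) `*` setT); split.
  + by apply: measurableX => //; exact: measurableX.
  + rewrite [LHS]product_measure1E//=; last exact: measurableX.
    by rewrite /leb2 product_measure1E// [X in (_ * X * _)%E]l0 mule0 mul0e.
  + by move=> y /= /negP/negPn; rewrite /coord (tnth_nth 0) /= => /eqP.
- exists (setT `*` [set c]); split.
  + exact: measurableX.
  + by rewrite [LHS]product_measure1E//= [X in (_ * X)%E]l0 mule0.
  + by move=> y /= /negP/negPn; rewrite /coord (tnth_nth 0) /= => /eqP.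
Qed.

End reflection.

(** * Integrability of convolutions in PM^2 *)

Section singular_kernel.
Variable R : realType.
Local Notation mR := (measurableTypeR R).
Local Notation mR3 := (mR * mR * mR)%type.
Local Notation R3 := (R * R * R)%type.
Local Notation leb1 := (@lebesgue_measure R).
Local Notation leb3 := (@leb3 R).

Lemma integral_powR (a b p : R) : 0 < a -> a < b -> p + 1 != 0 ->
  (\int[leb1]_(y in `[a, b]) (y `^ p)%:E =
   ((b `^ (p + 1) - a `^ (p + 1)) / (p + 1))%:E)%E.
Proof.
move=> a0 ab p1.
pose F (y : R) := (p + 1)^-1 * y `^ (p + 1).
have dF (y : R) : a <= y -> is_derive y 1 F (y `^ p).
  move=> ay; have y0 := lt_le_trans a0 ay.
  have -> : F = (p + 1)^-1 *: ((@powR R) ^~ (p + 1)) by apply/funext.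
  have := is_derive1_powR (p + 1) y0.
  rewrite addrK => ?; apply: is_derive_eq.
  by rewrite /GRing.scale/= mulrA mulVf// mul1r.
have cF (y : R) : a <= y -> {for y, continuous F}.
  move=> /dF[dy _]; apply: differentiable_continuous; exact/derivable1_diffP.
rewrite (@continuous_FTC2 R (fun y => y `^ p) F)//.
- by rewrite -EFinB /F -mulrBr mulrC.
- apply: derivable_within_continuous => y; rewrite in_itv/= => /andP[ay _].
  by apply: derivable_powR; rewrite in_itv/= andbT (lt_le_trans a0).
- split.
  + by move=> y; rewrite in_itv/= => /andP[/ltW/dF[]].
  + by apply: cvg_at_right_filter; exact: cF.
  + by apply: cvg_at_left_filter; apply: cF; exact: ltW.
- move=> y; rewrite in_itv/= => /andP[/ltW/dF[dy dyE] _].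
  by rewrite derive1E.
Qed.

Lemma measurable_powR_abs p : measurable_fun (setT : set mR) (fun y : mR => `|y| `^ p).
Proof.
apply: (@measurableT_comp _ _ _ _ _ _ (@powR R ^~ p)); first exact: measurable_powR.
exact: normr_measurable.
Qed.

Lemma integral_bigcup_lty (F : (set mR)^nat) (f : mR -> \bar R) (M : R) :
  nondecreasing_seq F -> (forall n, measurable (F n)) ->
  measurable_fun setT f -> (forall y, 0 <= f y)%E ->
  (forall n, (\int[leb1]_(y in F n) f y <= M%:E)%E) ->
  (\int[leb1]_(y in \bigcup_n F n) f y < +oo)%E.
Proof.
move=> ndF mF mf f0 FM.
have cf := @ge0_nondecreasing_set_cvg_integral _ _ _ F f leb1 ndF mF
  (fun n => measurable_funTS mf) (fun n y _ => f0 y).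
apply: (@le_lt_trans _ _ M%:E); last exact: ltry.
rewrite -(cvg_lim _ cf)//; apply: lime_le; first by apply/cvg_ex; eexists; exact: cf.
exact: nearW.
Qed.

Lemma invn_gt_exists (y : R) : 0 < y -> exists n : nat, n.+1%:R^-1 <= y.
Proof.
move=> y0; exists (Num.truncn y^-1).
rewrite -[leRHS]invrK lef_pV2 ?posrE ?invr_gt0// ltW//.
exact: truncnS_gt.
Qed.

Lemma integral_powR_near0 (r p : R) : -1 < p -> 0 < r ->
  (\int[leb1]_(y in `]0%R, r]) (`|y| `^ p)%:E < +oo)%E.
Proof.
move=> p1 r0.
have -> : `]0, r]%classic = \bigcup_n `[n.+1%:R^-1, r]%classic :> set R.
  apply/seteqP; split => y /=; rewrite in_itv/=.
    move=> /andP[y0 yr]; have [n hn] := invn_gt_exists y0.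
    by exists n => //=; rewrite in_itv/= hn.
  move=> [n _ /=]; rewrite in_itv/= => /andP[ny ->]; rewrite andbT.
  by apply: lt_le_trans ny; rewrite invr_gt0.
apply: (@integral_bigcup_lty _ _ (r `^ (p + 1) / (p + 1))) => //.
- move=> m n mn; apply/subsetPset => y /=; rewrite !in_itv/= => /andP[my ->].
  by rewrite andbT (le_trans _ my)// lef_pV2 ?posrE// ler_nat.
- by apply/measurable_EFinP; exact: measurable_powR_abs.
(* For small n the interval [1/(n+1), r] may be a single point or empty. *)
- move=> n; have [nr|rn] := ltP (n.+1%:R^-1) r; last first.
    have [->|rn'] := eqVneq r (n.+1%:R^-1).
      by rewrite set_itv1 integral_set1 lee_fin divr_ge0 ?powR_ge0//; lra.
    rewrite set_itv_ge ?integral_set0 ?lee_fin ?divr_ge0 ?powR_ge0//; first lra.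
    by rewrite bnd_simp -ltNge lt_neqAle rn' rn.
  rewrite (eq_integral (fun y : mR => ((y : R) `^ p)%:E)); last first.
    move=> y; rewrite inE/= in_itv/= => /andP[ny _].
    by rewrite ger0_norm// (le_trans _ ny)// invr_ge0.
  rewrite integral_powR ?invr_gt0//; last by apply/eqP; lra.
  rewrite lee_fin ler_pM2r ?invr_gt0; last lra.
  by rewrite gerBl powR_ge0.
Qed.

Lemma integral_powR_neary (r p : R) : p < -1 -> 0 < r ->
  (\int[leb1]_(y in `[r, +oo[) (`|y| `^ p)%:E < +oo)%E.
Proof.
move=> p1 r0.
have -> : `[r, +oo[%classic = \bigcup_n `[r, r + n.+1%:R]%classic :> set R.
  apply/seteqP; split => y /=; rewrite in_itv/= ?andbT.
    move=> ry; exists (Num.truncn (y - r)) => //=; rewrite in_itv/= ry/=.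
    by rewrite -lerBlDl ltW// truncnS_gt.
  by move=> [n _ /=]; rewrite in_itv/= => /andP[].
apply: (@integral_bigcup_lty _ _ (r `^ (p + 1) / - (p + 1))) => //.
- move=> m n mn; apply/subsetPset => y /=; rewrite !in_itv/= => /andP[-> /=].
  by move=> /le_trans; apply; rewrite lerD2l ler_nat.
- by apply/measurable_EFinP; exact: measurable_powR_abs.
- move=> n.
  rewrite (eq_integral (fun y : mR => ((y : R) `^ p)%:E)); last first.
    move=> y; rewrite inE/= in_itv/= => /andP[ny _].
    by rewrite ger0_norm// (le_trans _ ny)// ltW.
  rewrite integral_powR ?ltrDl//; last by apply/eqP; lra.
  rewrite lee_fin invrN mulrN mulrBl gerDr mulr_ge0_le0 ?powR_ge0// invr_le0.
  lra.
Qed.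

End singular_kernel.

(** * The convolution kernel *)

Section convolution_integrable.
Variable R : realType.
Local Notation mR := (measurableTypeR R).
Local Notation mR3 := (mR * mR * mR)%type.
Local Notation R3 := (R * R * R)%type.
Local Notation leb1 := (@lebesgue_measure R).
Local Notation leb3 := (@leb3 R).

(* k 0 = 0, by the convention of powR. *)
Let k (y : mR) : R := `|y| `^ (- (2 / 3)).

Let mk : measurable_fun setT k.
Proof. exact: measurable_powR_abs. Qed.

Let k_ge0 y : 0 <= k y. Proof. exact: powR_ge0. Qed.

Let kN y : k (- y) = k y. Proof. by rewrite /k normrN. Qed.

Let k_anti (r y : R) : 0 < r -> r <= `|y| -> k y <= k r.
Proof.
move=> r0 ry; rewrite /k (gtr0_norm r0) !powRN.
have y0 := lt_le_trans r0 ry.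
by rewrite lef_pV2 ?posrE ?powR_gt0// ge0_ler_powR// ?nnegrE ?ltW//; lra.
Qed.

(** The exponent 2/3 works because 2/3 < 1 < 4/3: a single factor is integrable at its singularity,
    and the product at infinity. The singular points 0 and x are 2r apart, so within distance r of
    one of them the other factor is at most [k r]; away from both, u v <= u^2 + v^2. *)
Lemma kernel_product_lty (x : R) : x != 0 ->
  (\int[leb1]_y (k (x - y)%R * k y)%:E < +oo)%E.
Proof.
move=> x0; pose r := `|x| / 2.
have r0 : 0 < r by rewrite divr_gt0// normr_gt0.
pose A : set mR := `]0, r]%classic; pose B : set mR := `[r, +oo[%classic.
have mA : measurable A by exact: measurable_itv.
have mB : measurable B by exact: measurable_itv.
pose f1 (y : mR) := (k r * k y)%:E.
pose f2 (y : mR) := (k y * k y)%:E.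
have mf1 : measurable_fun setT f1.
  by apply/measurable_EFinP; exact: measurable_funM.
have mf2 : measurable_fun setT f2.
  by apply/measurable_EFinP; exact: measurable_funM.
(* [P] is the majorant on the positive half-line, [Q] below makes it even, and [Q y + Q (x - y)]
   accounts for both singular points. *)
pose P y := ((f1 \_ A) y + (f2 \_ B) y)%E.
have mg1 : measurable_fun setT (f1 \_ A).
  by apply/(measurable_restrictT _ mA); exact: measurable_funTS.
have mg2 : measurable_fun setT (f2 \_ B).
  by apply/(measurable_restrictT _ mB); exact: measurable_funTS.
have f1_ge0 y : (0 <= f1 y)%E by rewrite lee_fin mulr_ge0.
have f2_ge0 y : (0 <= f2 y)%E by rewrite lee_fin mulr_ge0.
have g1_ge0 y : (0 <= (f1 \_ A) y)%E by apply: erestrict_ge0 => ? _; exact: f1_ge0.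
have g2_ge0 y : (0 <= (f2 \_ B) y)%E by apply: erestrict_ge0 => ? _; exact: f2_ge0.
have mP : measurable_fun setT P by exact: emeasurable_funD.
have P_ge0 y : (0 <= P y)%E by exact: adde_ge0.
have IP : (\int[leb1]_y P y < +oo)%E.
  rewrite ge0_integralD// -!integral_mkcond; apply: lte_add_pinfty.
    under eq_integral do rewrite /f1 EFinM.
    rewrite ge0_integralZl_EFin//.
    - apply: lte_mul_pinfty; rewrite ?lee_fin//.
      by apply: integral_powR_near0 => //; lra.
    - by move=> y _; rewrite lee_fin.
    - by apply: measurable_funTS; exact/measurable_EFinP.
  rewrite (eq_integral (fun y : mR => (`|y| `^ (- (4 / 3)))%:E)).
    by apply: integral_powR_neary => //; lra.
  move=> y _; rewrite /f2 /k; have [->|y0] := eqVneq (y : R) 0.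
    by rewrite normr0 !powR0 ?mul0r//; apply/eqP; lra.
  rewrite -powRD; last by rewrite normr_eq0 y0 implybT.
  by congr ((_ `^ _)%:E); lra.
pose Q y := (P y + P (0 - y)%R)%E.
have mP' (c : R) : measurable_fun setT (fun y : mR => P (c - y)%R).
  apply: measurableT_comp => //; exact: measurable_refl.
have mQ : measurable_fun setT Q by exact: emeasurable_funD.
have Q_ge0 y : (0 <= Q y)%E by exact: adde_ge0.
have IQ : (\int[leb1]_y Q y < +oo)%E.
  rewrite ge0_integralD// lebesgue_integral_refl//.
  exact: lte_add_pinfty.
have QA (y : R) : y != 0 -> `|y| <= r -> ((k r * k y)%:E <= Q y)%E.
  move=> y0 yr; have [yp|yn] := ltP 0 y.
    have yA : A y by rewrite /A /= in_itv/= yp -(gtr0_norm yp).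
    rewrite /Q /P {1}patchT ?inE//.
    apply: le_trans (leeDl _ _); last exact: adde_ge0.
    exact: leeDl.
  have yA : A (0 - y).
    by rewrite /A /= in_itv/= sub0r oppr_gt0 lt_neqAle y0 yn/= -(ler0_norm yn).
  rewrite /Q /P [X in (_ + (X + _))%E]patchT ?inE//.
  apply: le_trans (leeDr _ _); last exact: adde_ge0.
  rewrite /f1 sub0r kN; exact: leeDl.
have QB (y : R) : r <= `|y| -> ((k y * k y)%:E <= Q y)%E.
  move=> ry; have [yp|yn] := leP 0 y.
    have yB : B y by rewrite /B /= in_itv/= andbT -(ger0_norm yp).
    rewrite /Q /P [X in (_ + X + _)%E]patchT ?inE//.
    apply: le_trans (leeDl _ _); last exact: adde_ge0.
    exact: leeDr.
  have yB : B (0 - y) by rewrite /B /= in_itv/= andbT sub0r -(ltr0_norm yn).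
  rewrite /Q /P [X in (_ + (_ + X))%E]patchT ?inE//.
  apply: le_trans (leeDr _ _); last exact: adde_ge0.
  by rewrite /f2 sub0r kN; exact: leeDr.
have mQ' : measurable_fun setT (fun y : mR => Q (x - y)%R).
  by apply: measurableT_comp => //; exact: measurable_refl.
apply: (@le_lt_trans _ _ (\int[leb1]_y (Q y + Q (x - y)%R)%E)%E); last first.
  rewrite ge0_integralD// lebesgue_integral_refl//.
  exact: lte_add_pinfty.
apply: ge0_le_integral => //.
- by move=> y _; rewrite lee_fin mulr_ge0.
- apply/measurable_EFinP; apply: measurable_funM => //.
  by apply: measurableT_comp => //; exact: measurable_refl.
- exact: emeasurable_funD.
- move=> y _.
  (* At y = 0 and y = x the integrand is 0, so the comparison holds at every point. *)
  have k0 : k 0 = 0 by rewrite /k normr0 powR0//; apply/eqP; lra.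
  have [->|y0] := eqVneq (y : R) 0; first by rewrite k0 mulr0 adde_ge0.
  have [->|xy0] := eqVneq (x - y : R) 0; first by rewrite k0 mul0r adde_ge0.
  have [yr|ry] := leP `|y| r.
    apply: (@le_trans _ _ (k r * k y)%:E); last first.
      apply: le_trans (leeDl _ _); last exact: Q_ge0.
      exact: QA.
    rewrite lee_fin ler_wpM2r// k_anti//.
    have := ler_normD (x - y) y; rewrite subrK /r in yr *; lra.
  have [xyr|rxy] := leP `|x - y| r.
    apply: (@le_trans _ _ (k r * k (x - y)%R)%:E); last first.
      apply: le_trans (leeDr _ _); last exact: Q_ge0.
      exact: QA.
    by rewrite lee_fin mulrC ler_wpM2r// k_anti// ltW.
  apply: le_trans (leeD (QB _ (ltW ry)) (QB _ (ltW rxy))).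
  rewrite -EFinD lee_fin.
  have := k_ge0 y; have := k_ge0 (x - y)%R; move: (k y) (k _) => u v; nra.
Qed.

Lemma product_integral_lty d1 d2 (T1 : measurableType d1) (T2 : measurableType d2)
  (m1 : {sigma_finite_measure set T1 -> \bar R})
  (m2 : {sigma_finite_measure set T2 -> \bar R}) (f : T1 -> R) (g : T2 -> R) :
  measurable_fun setT f -> measurable_fun setT g ->
  (forall x, 0 <= f x) -> (forall y, 0 <= g y) ->
  (\int[m1]_x (f x)%:E < +oo)%E -> (\int[m2]_y (g y)%:E < +oo)%E ->
  (\int[(m1 \x m2)%E]_p (f p.1 * g p.2)%:E < +oo)%E.
Proof.
move=> mf mg f0 g0 If Ig.
rewrite fubini_tonelli1//=; last first.
- by move=> p; rewrite lee_fin mulr_ge0.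
- apply/measurable_EFinP; apply: measurable_funM; exact: measurableT_comp.
rewrite /fubini_F/=.
under eq_integral do (under eq_integral do rewrite EFinM).
have I0 : (0 <= \int[m2]_y (g y)%:E)%E by apply: integral_ge0 => y _; rewrite lee_fin.
have [G IG] : exists G, (\int[m2]_y (g y)%:E)%E = G%:E.
  by exists (fine (\int[m2]_y (g y)%:E)%E); rewrite fineK// ge0_fin_numE.
have G0 : 0 <= G by rewrite -lee_fin -IG.
rewrite (eq_integral (fun x => (G%:E * (f x)%:E)%E)); last first.
  move=> x _; rewrite ge0_integralZl_EFin//.
  - by rewrite IG muleC.
  - by move=> y _; rewrite lee_fin.
  - exact/measurable_EFinP.
rewrite ge0_integralZl_EFin//.
- exact: lte_mul_pinfty.
- by move=> x _; rewrite lee_fin.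
- exact/measurable_EFinP.
Qed.

Lemma enorm_ge_coord (y : R3) j : `|coord y j| <= enorm y.
Proof.
rewrite -sqrtr_sqr ler_wsqrtr// /dot (bigD1 j)//= expr2 lerDl.
by apply: sumr_ge0 => i _; rewrite -expr2 sqr_ge0.
Qed.

Lemma enorm_ge0 (y : R3) : 0 <= enorm y.
Proof. exact: sqrtr_ge0. Qed.

Lemma enorm_sqr (y : R3) : enorm y ^+ 2 = dot y y.
Proof. by rewrite sqr_sqrtr// sumr_ge0// => i _; rewrite -expr2 sqr_ge0. Qed.

Lemma enorm_gt0 (y : R3) : (forall j, coord y j != 0) -> 0 < enorm y.
Proof.
by move=> y0; apply: lt_le_trans (enorm_ge_coord y ord0); rewrite normr_gt0.
Qed.

(** Each of the three factors |y|^(-2/3) is compared with one coordinate. On the coordinate planes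
    the bound would fail, its right side being 0 there. *)
Lemma invr_enorm_sqr_le (y : R3) : (forall j, coord y j != 0) ->
  (enorm y ^+ 2)^-1 <= k y.1.1 * k y.1.2 * k y.2.
Proof.
move=> y0; have e0 := enorm_gt0 y0.
have -> : (enorm y ^+ 2)^-1 = enorm y `^ (- (2/3)) * enorm y `^ (- (2/3)) * enorm y `^ (- (2/3)).
  rewrite -powR_mulrn ?enorm_ge0// -powRN -!powRD ?(gt_eqF e0) ?implybT//.
  by congr (_ `^ _); lra.
have H j : enorm y `^ (- (2/3)) <= k (coord y j).
  rewrite /k !powRN lef_pV2 ?posrE ?powR_gt0 ?normr_gt0//.
  by rewrite ge0_ler_powR ?nnegrE ?enorm_ge0 ?enorm_ge_coord//; lra.
have c j : coord y j = [:: y.1.1; y.1.2; y.2]`_j by rewrite /coord (tnth_nth 0).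
have := H ord0; have := H (inord 1); have := H (inord 2); rewrite !c !inordK//= => h2 h1 h0.
apply: ler_pM => //; rewrite ?mulr_ge0 ?powR_ge0//.
by apply: ler_pM => //; exact: powR_ge0.
Qed.

(* The kernel |xi - y|^-2 |y|^-2 is dominated by a product of one-dimensional
   kernels, since |y|^2 >= |y_1 y_2 y_3|^(2/3). *)
Lemma convolution_kernel_integrable (xi : R3) : (forall j, coord xi j != 0) ->
  exists b : mR3 -> R, leb3.-integrable setT (EFin \o b) /\
    {ae leb3, forall y, (enorm (xi - y) ^+ 2)^-1 * (enorm y ^+ 2)^-1 <= b y}.
Proof.
move=> xi0.
pose g (x y : mR) := k (x - y)%R * k y.
have mg x : measurable_fun setT (g x).
  apply: measurable_funM => //.
  by apply: measurableT_comp => //; exact: measurable_refl.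
have g0 x y : 0 <= g x y by rewrite mulr_ge0.
have c j : coord xi j = [:: xi.1.1; xi.1.2; xi.2]`_j by rewrite /coord (tnth_nth 0).
pose b (y : mR3) := g xi.1.1 y.1.1 * g xi.1.2 y.1.2 * g xi.2 y.2.
exists b; split.
  have m12 : measurable_fun setT (fun p : (mR * mR)%type => g xi.1.1 p.1 * g xi.1.2 p.2).
    by apply: measurable_funM; apply: measurableT_comp.
  apply/integrableP; split.
    apply/measurable_EFinP; apply: measurable_funM.
      by apply: (measurableT_comp m12).
    exact: measurableT_comp.
  under eq_integral => y _ do rewrite /= ger0_norm ?mulr_ge0//.
  have xi1 : xi.1.1 != 0 by have := xi0 ord0; rewrite c.
  have xi2 : xi.1.2 != 0 by have := xi0 (inord 1); rewrite c inordK.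
  have xi3 : xi.2 != 0 by have := xi0 (inord 2); rewrite c inordK.
  apply: (@product_integral_lty _ _ _ _ (@leb2 R) leb1
    (fun p => g xi.1.1 p.1 * g xi.1.2 p.2) (g xi.2)) => //.
  - by move=> p; rewrite mulr_ge0.
  - apply: (@product_integral_lty _ _ _ _ leb1 leb1 (g xi.1.1) (g xi.1.2)) => //;
      exact: kernel_product_lty.
  - exact: kernel_product_lty.
have h1 : {ae leb3, forall y, forall j, coord y j != 0}.
  by apply: filter_forall => j; exact: ae_coord_neq.
apply: filterS2 h1 (ae_leb3_refl xi h1) => y y0 xy0.
have := invr_enorm_sqr_le y0; have := invr_enorm_sqr_le xy0.
move=> H1 H2; rewrite /b /g.
apply: le_trans (ler_pM _ _ H1 H2) _; rewrite ?invr_ge0 ?exprn_ge0 ?enorm_ge0//.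
rewrite le_eqVlt; apply/orP; left; apply/eqP; rewrite /=; ring.
Qed.

End convolution_integrable.

(** * Splitting of the nonlinear symbol and the Leray projector *)

Section bilinear_algebra.
Variable R : realType.
Local Notation mR := (measurableTypeR R).
Local Notation mR3 := (mR * mR * mR)%type.
Local Notation R3 := (R * R * R)%type.
Local Notation C3 := ('I_3 -> R[i]).
Local Notation leb3 := (@leb3 R).
Implicit Types (f g u v w : R3 -> C3) (xi : R3).

Definition vmeasurable f : Prop :=
  forall j, cmeasurable (setT : set mR3) (fun xi => f xi j).

Definition PMbound f (K : R) : Prop :=
  {ae leb3, forall xi, enorm xi ^+ 2 * cnorm (f xi) <= K}.

Lemma ae_coords_neq0 : {ae leb3, forall xi, forall j, coord xi j != 0}.
Proof. by apply: filter_forall => j; exact: ae_coord_neq. Qed.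

Lemma cmeasurable_refl (h : R3 -> R[i]) xi : cmeasurable (setT : set mR3) h ->
  cmeasurable (setT : set mR3) (fun y => h (xi - y)).
Proof.
move=> [h1 h2]; split.
- exact: (measurableT_comp h1 (measurable_refl3 xi)).
- exact: (measurableT_comp h2 (measurable_refl3 xi)).
Qed.

Lemma vmeasurableB f g : vmeasurable f -> vmeasurable g ->
  vmeasurable (fun xi j => f xi j - g xi j).
Proof. by move=> mf mg j; exact: cmeasurableB. Qed.

Lemma conv_integrable f g K L xi k j : vmeasurable f -> vmeasurable g ->
  PMbound f K -> PMbound g L -> (forall j, coord xi j != 0) ->
  cintegrable leb3 setT (fun y => f (xi - y) k * g y j).
Proof.
move=> mf mg fK gL xi0; have [b [ib hb]] := convolution_kernel_integrable xi0.
apply: (@cintegrable_le _ _ _ _ _ measurableT _ (fun y => (`|K| * `|L|) * b y)).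
- exact: cmeasurableM (@cmeasurable_refl (fun z => f z k) xi (mf k)) (mg j).
- exact: integrableZl_EFin.
- have H (h : R3 -> C3) M y i : (forall j, coord y j != 0) ->
      enorm y ^+ 2 * cnorm (h y) <= M -> normc (h y i) <= `|M| * (enorm y ^+ 2)^-1.
    move=> /enorm_gt0 y0 hM; rewrite ler_pdivlMr ?exprn_gt0// mulrC.
    apply: le_trans (ler_norm M); apply: le_trans hM.
    by rewrite ler_wpM2l ?exprn_ge0 ?enorm_ge0// normc_le_cnorm.
  have h0 := ae_coords_neq0.
  have F1 : {ae leb3, forall y, normc (f y k) <= `|K| * (enorm y ^+ 2)^-1}.
    by apply: filterS2 h0 fK => y y0; exact: H.
  have F2 : {ae leb3, forall y, normc (g y j) <= `|L| * (enorm y ^+ 2)^-1}.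
    by apply: filterS2 h0 gL => y y0; exact: H.
  apply: filterS3 hb (ae_leb3_refl xi F1) F2 => y hb h1 h2 _.
  rewrite ComplexField.Normc.normcM; apply: (le_trans (ler_pM _ _ h1 h2));
    rewrite ?normc_ge0// mulrACA.
  by rewrite ler_wpM2l ?mulr_ge0.
Qed.

Lemma eq_ae_tensor_hat f f' g g' xi k j :
  vmeasurable f -> vmeasurable f' -> vmeasurable g -> vmeasurable g' ->
  {ae leb3, forall y, f y = f' y} -> {ae leb3, forall y, g y = g' y} ->
  tensor_hat f g xi k j = tensor_hat f' g' xi k j.
Proof.
move=> mf mf' mg mg' ff' gg'; congr (_ * _); apply: ae_eq_cint => //.
- exact: cmeasurableM (@cmeasurable_refl (fun z => f z k) xi (mf k)) (mg j).
- exact: cmeasurableM (@cmeasurable_refl (fun z => f' z k) xi (mf' k)) (mg' j).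
- by apply: filterS2 (ae_leb3_refl xi ff') gg' => y -> ->.
Qed.

Lemma eq_ae_div_tensor_hat f f' g g' xi :
  vmeasurable f -> vmeasurable f' -> vmeasurable g -> vmeasurable g' ->
  {ae leb3, forall y, f y = f' y} -> {ae leb3, forall y, g y = g' y} ->
  div_tensor_hat f g xi = div_tensor_hat f' g' xi.
Proof.
move=> *; apply/funext => j; apply: eq_bigr => k _; congr (_ * _).
exact: eq_ae_tensor_hat.
Qed.

(** The identity u (x) u - v (x) v = u (x) w + w (x) v holds under the convolution integral; the
    bounds [K] and [L] make all four integrals converge, so that they may be combined. *)
Lemma div_tensor_hat_diff u v K L xi : vmeasurable u -> vmeasurable v ->
  PMbound u K -> PMbound v L -> (forall j, coord xi j != 0) ->
  let w := fun xi j => u xi j - v xi j in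
  forall j, div_tensor_hat u u xi j - div_tensor_hat v v xi j =
    div_tensor_hat u w xi j + div_tensor_hat w v xi j.
Proof.
move=> mu mv uK vL xi0 w j.
have mw : vmeasurable w by exact: vmeasurableB.
have wb : PMbound w (K + L).
  apply: filterS2 uK vL => y h1 h2; apply: le_trans (lerD h1 h2).
  by rewrite -mulrDr ler_wpM2l ?exprn_ge0 ?enorm_ge0// cnormB.
rewrite /div_tensor_hat -sumrB -big_split/=; apply: eq_bigr => k _.
rewrite -mulrBr -mulrDr; congr (_ * _); rewrite /tensor_hat -mulrBr -mulrDr; congr (_ * _).
have ii f g K' L' := @conv_integrable f g K' L' xi k j.
rewrite /conv -cintB//; last 2 first.
- exact: (ii _ _ K K).
- exact: (ii _ _ L L).
rewrite -cintD//; last 2 first.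
- exact: (ii _ _ K (K + L)).
- exact: (ii _ _ (K + L) L).
congr (cint _ _ _); apply/funext => y; rewrite /w; ring.
Qed.

Lemma lerayD xi (a b c : C3) : (forall j, c j = a j + b j) ->
  forall j, leray xi c j = leray xi a j + leray xi b j.
Proof.
by move=> cE j; rewrite /leray -big_split/=; apply: eq_bigr => k _; rewrite cE mulrDr.
Qed.

Lemma lerayB xi (a b c : C3) : (forall j, c j = a j - b j) ->
  forall j, leray xi c j = leray xi a j - leray xi b j.
Proof.
by move=> cE j; rewrite /leray -sumrB; apply: eq_bigr => k _; rewrite cE mulrBr.
Qed.

(** A crude count: three rows of three entries of size at most 2. The sharp constant 1 is not called
    for, since this bound is applied to forces only. *)
Lemma leray_le xi (a : C3) : cnorm (leray xi a) <= 18 * cnorm a.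
Proof.
have n1 (x : R) : normc (x%:C)%C = `|x| by rewrite /= expr0n/= addr0 sqrtr_sqr.
have cf (j k : 'I_3) : `|(j == k)%:R - coord xi j * coord xi k / dot xi xi| <= 2.
  apply: le_trans (ler_normB _ _) _.
  have -> : 2 = 1 + 1 :> R by ring.
  apply: lerD; first by rewrite normr_nat; case: (j == k); rewrite ?ler01.
  have [->|d0] := eqVneq (dot xi xi) 0; first by rewrite invr0 mulr0 normr0 ler01.
  have dp : 0 < dot xi xi.
    by rewrite lt_neqAle eq_sym d0/= -enorm_sqr exprn_ge0// enorm_ge0.
  rewrite normrM normfV (gtr0_norm dp) ler_pdivrMr// mul1r normrM -enorm_sqr expr2.
  by rewrite ler_pM// enorm_ge_coord.
apply: le_trans (cnorm_le_sum _) _.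
have -> : 18 * cnorm a = \sum_(j < 3) (6 * cnorm a).
  by rewrite !big_ord_recl big_ord0; ring.
apply: ler_sum => j _; rewrite /leray.
have N (z1 z2 z3 : R[i]) : normc (z1 + (z2 + z3)) <= normc z1 + (normc z2 + normc z3).
  by apply: le_trans (le_normcD _ _) _; rewrite lerD2l; exact: le_normcD.
rewrite !big_ord_recl big_ord0 addr0; apply: le_trans (N _ _ _) _.
have H k : normc (((j == k)%:R - coord xi j * coord xi k / dot xi xi)%:C%C * a k) <= 2 * cnorm a.
  rewrite ComplexField.Normc.normcM n1 ler_pM ?normc_ge0//; exact: normc_le_cnorm.
apply: le_trans (lerD (H _) (lerD (H _) (H _))) _.
by rewrite le_eqVlt; apply/orP; left; apply/eqP; ring.
Qed.

End bilinear_algebra.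

(** * The pointwise bound on the nonlinear symbol *)

Section heat_integral.
Variable R : realType.
Local Notation mR := (measurableTypeR R).
Local Notation mR3 := (mR * mR * mR)%type.
Local Notation R3 := (R * R * R)%type.
Local Notation C3 := ('I_3 -> R[i]).
Local Notation leb1 := (@lebesgue_measure R).
Local Notation leb3 := (@leb3 R).

Lemma is_derive_heat (t s x : R) :
  is_derive x 1 (fun tau : R => expR (- ((t - tau) * s))) (s * expR (- ((t - x) * s))).
Proof.
have -> : (fun tau : R => expR (- ((t - tau) * s))) = expR \o ((fun tau => tau * s) - cst (t * s)).
  by apply/funext => y; rewrite /= !fctE; congr expR; ring.
apply: is_derive_eq.
rewrite !fctE /GRing.scale /=.
have -> : x * s - t * s = - ((t - x) * s) by ring.
ring.
Qed.

Lemma continuous_heat (t s : R) : continuous (fun tau : R => expR (- ((t - tau) * s))).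
Proof.
move=> x; apply: differentiable_continuous; apply/derivable1_diffP.
by have [] := is_derive_heat t s x.
Qed.

Lemma integral_heat (t s a b : R) : a <= b -> 0 < s ->
  (\int[leb1]_(tau in `[a, b]) (expR (- ((t - tau) * s)))%:E =
   ((expR (- ((t - b) * s)) - expR (- ((t - a) * s))) / s)%:E)%E.
Proof.
move=> + s0; rewrite le_eqVlt => /orP[/eqP ->|ab].
  by rewrite set_itv1 integral_set1 subrr mul0r.
pose F (x : R) := s^-1 * expR (- ((t - x) * s)).
have dF (x : R) : is_derive x 1 F (expR (- ((t - x) * s))).
  have -> : F = s^-1 *: (fun tau : R => expR (- ((t - tau) * s))) by [].
  have ? := is_derive_heat t s x.
  apply: is_derive_eq; rewrite /GRing.scale/= mulrA mulVf ?mul1r// gt_eqF//.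
have cF (x : R) : {for x, continuous F}.
  by apply: differentiable_continuous; apply/derivable1_diffP; have [] := dF x.
rewrite (@continuous_FTC2 R (fun tau => expR (- ((t - tau) * s))) F)//.
- by rewrite -EFinB /F -mulrBr mulrC.
- apply: continuous_subspaceT; exact: continuous_heat.
- split.
  + by move=> y _; have [] := dF y.
  + exact: cvg_at_right_filter (cF _).
  + exact: cvg_at_left_filter (cF _).
- by move=> y _; rewrite derive1E; have [_ ->] := dF y.
Qed.

Lemma Rintegral_heat (t s a b : R) : a <= b -> 0 < s ->
  Rintegral leb1 `[a, b] (fun tau : mR => expR (- ((t - tau) * s))) =
  (expR (- ((t - b) * s)) - expR (- ((t - a) * s))) / s.
Proof. by move=> ab s0; rewrite /Rintegral integral_heat. Qed.

Lemma integrable_heat (t s a b : R) :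
  leb1.-integrable `[a, b] (EFin \o (fun tau : mR => expR (- ((t - tau) * s)))).
Proof.
apply: continuous_compact_integrable; first exact: segment_compact.
apply: continuous_subspaceT; exact: continuous_heat.
Qed.

Lemma cint_heat_cst (t a b : R) (xi : R3) (c : R[i]) : a <= b -> 0 < dot xi xi ->
  cint leb1 `[a, b] (fun tau : R => heat (t - tau) xi * c) =
  (((expR (- ((t - b) * dot xi xi)) - expR (- ((t - a) * dot xi xi))) / dot xi xi)%:C * c)%C.
Proof.
move=> ab s0; set s := dot xi xi in s0 *.
have ih := integrable_heat t s a b.
have H (x : R) : Rintegral leb1 `[a, b] (fun tau : mR => expR (- ((t - tau) * s)) * x) =
    (expR (- ((t - b) * s)) - expR (- ((t - a) * s))) / s * x.
  by rewrite -Rintegral_heat// RintegralZr.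
apply: complexP.
- rewrite ReM /= mul0r subr0 -H; apply: eq_Rintegral => tau _.
  by rewrite ReM /= mul0r subr0.
- rewrite ImM /= mul0r addr0 -H; apply: eq_Rintegral => tau _.
  by rewrite ImM /= mul0r addr0.
Qed.

End heat_integral.

(** * From the operator bound on B to its symbol *)

Section pointwise_bilinear.
Variables (R : realType) (eta : R).
Local Notation mR := (measurableTypeR R).
Local Notation mR3 := (mR * mR * mR)%type.
Local Notation R3 := (R * R * R)%type.
Local Notation C3 := ('I_3 -> R[i]).
Local Notation leb1 := (@lebesgue_measure R).
Local Notation leb3 := (@leb3 R).
Hypothesis B_eta : B_bounded eta.

Lemma vmeasurable_hat a (v : vdist R) : PM a v -> vmeasurable (hat v).
Proof. by move=> /vfourier_rep_hat h j; have [] := h j. Qed.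

Lemma CwPM_cst a (v : vdist R) : PM a v ->
  CwPM a (fun=> v) /\ CwPMnorm a (fun=> v) = PMnorm a v.
Proof.
move=> Pv.
have E : CwPMnorm a (fun=> v) = PMnorm a v.
  rewrite /CwPMnorm /hatnormX.
  have -> : [set hatnorm a (hat v) | t in [set t : R | 0 <= t]] = [set hatnorm a (hat v)].
    by apply/seteqP; split => [_ [t _ <-]|_ ->] //; exists 0 => //=.
  by rewrite ereal_sup1.
split=> //; split => //.
- by rewrite E; case: Pv.
- by move=> j phi sphi; split; apply: continuous_subspaceT; exact: cst_continuous.
Qed.

Lemma spacetime_hat_cst a (v : vdist R) : PM a v ->
  spacetime_hat (fun=> v) (fun=> hat v).
Proof.
move=> Pv; split; last by move=> t _; exact: aeW.
move=> j; have [m1 m2] := vmeasurable_hat Pv j.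
split; apply: measurable_funTS.
- exact: (measurableT_comp m1 measurable_snd).
- exact: (measurableT_comp m2 measurable_snd).
Qed.

Lemma hatnormX_leP a (f : R -> R3 -> C3) (M : \bar R) :
  (hatnormX a f <= M)%E <-> forall t, 0 <= t -> (hatnorm a (f t) <= M)%E.
Proof.
split=> [h t t0|h].
  by apply: le_trans h; apply: ereal_sup_ubound; exists t.
by apply: ge_ereal_sup => _ [t t0 <-]; exact: h.
Qed.

(* For data constant in time, B(a, b) is the nonlinear symbol times
   (1 - e^(-t |xi|^2)) / |xi|^2, so letting t -> +oo in the bound on B yields a
   pointwise bound on the symbol with the same constant. *)
Lemma bilinear_symbol_le (a b : vdist R) (A B : R) : PM 2 a -> PM 2 b ->
  (PMnorm 2 a <= A%:E)%E -> (PMnorm 2 b <= B%:E)%E -> 0 <= eta ->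
  {ae leb3, forall xi,
    cnorm (leray xi (div_tensor_hat (hat a) (hat b) xi)) <= eta * A * B}.
Proof.
move=> Pa Pb aA bB eta0.
have [Ca Ea] := CwPM_cst Pa; have [Cb Eb] := CwPM_cst Pb.
have := B_eta Ca Cb (spacetime_hat_cst Pa) (spacetime_hat_cst Pb).
rewrite Ea Eb => H.
have {}H : (hatnormX 2 (B_hat (fun=> hat a) (fun=> hat b)) <= (eta * A * B)%:E)%E.
  apply: le_trans H _; rewrite !EFinM; apply: lee_pmul => //.
  - by rewrite mule_ge0// ?lee_fin// hatnorm_ge0.
  - exact: hatnorm_ge0.
  - by apply: lee_wpmul2l; rewrite ?lee_fin.
(* Integer times suffice for the limit and leave only countably many null sets to unite. *)
have {}H : {ae leb3, forall xi, forall n : nat,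
    enorm xi `^ 2 * cnorm (B_hat (fun=> hat a) (fun=> hat b) n%:R xi) <= eta * A * B}.
  apply/ae_foralln => n.
  have /hatnormX_leP /(_ n%:R (ler0n _ n)) /hatnorm_leP := H.
  by apply: filterS => xi; rewrite lee_fin.
apply: filterS2 H (ae_coords_neq0 R) => xi H /enorm_gt0 xi0.
set c := leray _ _.
have s0 : 0 < dot xi xi by rewrite -enorm_sqr exprn_gt0.
have {}H (n : nat) : (1 - expR (- (n%:R * dot xi xi))) * cnorm c <= eta * A * B.
  have := H n; rewrite powR_mulrn ?enorm_ge0// enorm_sqr.
  have -> : B_hat (fun=> hat a) (fun=> hat b) n%:R xi =
     (fun j => - (((1 - expR (- (n%:R * dot xi xi))) / dot xi xi)%:C * c j)%C).
    apply/funext => j; rewrite /B_hat cint_heat_cst//.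
    by rewrite subr0 subrr mul0r oppr0 expR0.
  have e1 : expR (- (n%:R * dot xi xi)) <= 1.
    by rewrite -expR0 ler_expR oppr_le0 mulr_ge0// ltW.
  rewrite (cnormN (fun j => _)) cnorm_scale; last by rewrite divr_ge0 ?subr_ge0// ltW.
  by rewrite mulrA (mulrC (dot _ _)) divfK ?gt_eqF//.
have L : (1 - expR (- (n%:R * dot xi xi))) * cnorm c @[n --> \oo] --> cnorm c.
  rewrite -[X in _ --> X]mul1r; apply: cvgMl.
  rewrite -[X in _ --> X](subr0 1); apply: cvgB; first exact: cvg_cst.
  apply: expRN_cvg0.
  exact: (cvg_comp _ (fun x => x * dot xi xi) (@cvgr_idn R) (gt0_cvgMly s0 (@cvg_id _ _))).
rewrite -(cvg_lim _ L)//; apply: limr_le; first by apply/cvg_ex; eexists; exact: L.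
exact: nearW.
Qed.

End pointwise_bilinear.

(** * Measurability in space-time *)

Section joint_measurability.
Variable R : realType.
Local Notation mR := (measurableTypeR R).
Local Notation mR3 := (mR * mR * mR)%type.
Local Notation R3 := (R * R * R)%type.
Local Notation C3 := ('I_3 -> R[i]).
Local Notation leb3 := (@leb3 R).

(** Convolutions may diverge at exceptional frequencies, so Tonelli is applied to the positive and
    negative parts; [fine] sends infinite values to 0 and keeps measurability. *)
Lemma measurable_Rintegral_section d1 d2 (T1 : measurableType d1) (T2 : measurableType d2)
  (m2 : {sigma_finite_measure set T2 -> \bar R}) (F : T1 * T2 -> R) :
  measurable_fun setT F -> measurable_fun setT (fun x => Rintegral m2 setT (fun y => F (x, y))).
Proof.
move=> mF; apply: (measurableT_comp (f := @fine R)); first exact: fine_measurable.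
have mE : measurable_fun setT (EFin \o F) by exact/measurable_EFinP.
have -> : (fun x => \int[m2]_y (F (x, y))%:E)%E =
  (fun x => fubini_F m2 ((EFin \o F)^\+)%E x - fubini_F m2 ((EFin \o F)^\-)%E x)%E.
  apply/funext => x; rewrite integralE /fubini_F; congr (_ - _)%E; apply: eq_integral => y _.
    by rewrite !funeposE.
  by rewrite !funenegE.
apply: emeasurable_funB; apply: measurable_fun_fubini_tonelli_F => //.
- exact: measurable_funepos.
- exact: measurable_funeneg.
Qed.

Lemma cmeasurable_cint_section d1 d2 (T1 : measurableType d1) (T2 : measurableType d2)
  (m2 : {sigma_finite_measure set T2 -> \bar R}) (F : T1 * T2 -> R[i]) :
  cmeasurable setT F -> cmeasurable setT (fun x => cint m2 setT (fun y => F (x, y))).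
Proof.
move=> [F1 F2]; split.
- exact: (measurable_Rintegral_section m2 F1).
- exact: (measurable_Rintegral_section m2 F2).
Qed.

Definition stmeasurable (f : R -> R3 -> C3) : Prop :=
  forall j, cmeasurable (setT : set (mR * mR3)%type) (fun p => f p.1 p.2 j).

Lemma cmeasurable_comp d1 d2 (T1 : measurableType d1) (T2 : measurableType d2)
  (f : T2 -> R[i]) (g : T1 -> T2) : cmeasurable setT f -> measurable_fun setT g ->
  cmeasurable setT (f \o g).
Proof.
move=> [f1 f2] mg; split.
- exact: (measurableT_comp f1 mg).
- exact: (measurableT_comp f2 mg).
Qed.

Lemma cmeasurable_real d (T : measurableType d) (D : set T) (f : T -> R) : measurable_fun D f ->
  cmeasurable D (fun x => (f x)%:C)%C.
Proof. by move=> mf; split => //=; exact: measurable_cst. Qed.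

Lemma cmeasurable_cst d (T : measurableType d) (D : set T) (c : R[i]) :
  cmeasurable D (fun=> c).
Proof. by split; exact: measurable_cst. Qed.

Let msub : measurable_fun setT (fun q : (mR * mR3) * mR3 => ((q.1.2 : R3) - q.2 : mR3)).
Proof.
have m1 j : measurable_fun setT (fun q : (mR * mR3) * mR3 => coord (q.1.2) j - coord q.2 j : mR).
  apply: measurable_funB.
    apply: (measurableT_comp (measurable_coord j)).
    exact: (measurableT_comp measurable_snd measurable_fst).
  exact: (measurableT_comp (measurable_coord j) measurable_snd).
have E j (x : R3) : coord x j = [:: x.1.1; x.1.2; x.2]`_j by rewrite /coord (tnth_nth 0).
apply: measurable_fun_pair; first apply: measurable_fun_pair.
- by have := m1 ord0; under eq_fun do rewrite !E /=.
- by have := m1 (inord 1); under eq_fun do rewrite !E !inordK//=.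
- by have := m1 (inord 2); under eq_fun do rewrite !E !inordK//=.
Qed.

Lemma cmeasurable_conv (f g : R -> R3 -> C3) k j : stmeasurable f -> stmeasurable g ->
  cmeasurable (setT : set (mR * mR3)%type)
    (fun p => conv (fun y => f p.1 y k) (fun y => g p.1 y j) p.2).
Proof.
move=> mf mg.
apply: (@cmeasurable_cint_section _ _ _ _ leb3
  (fun q : (mR * mR3) * mR3 => f q.1.1 (q.1.2 - q.2) k * g q.1.1 q.2 j)).
have m11 : measurable_fun setT (fun q : (mR * mR3) * mR3 => q.1.1).
  exact: (measurableT_comp measurable_fst measurable_fst).
apply: cmeasurableM.
- apply: (cmeasurable_comp (g := fun q : (mR * mR3) * mR3 => (q.1.1, (q.1.2 : R3) - q.2)) (mf k)).
  exact: measurable_fun_pair.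
- apply: (cmeasurable_comp (g := fun q : (mR * mR3) * mR3 => (q.1.1, q.2)) (mg j)).
  exact: measurable_fun_pair.
Qed.

Let mcoord2 j : measurable_fun setT (fun p : mR * mR3 => coord p.2 j : mR).
Proof. exact: (measurableT_comp (measurable_coord j) measurable_snd). Qed.

Lemma stmeasurable_div_tensor (f g : R -> R3 -> C3) : stmeasurable f -> stmeasurable g ->
  stmeasurable (fun t xi => div_tensor_hat (f t) (g t) xi).
Proof.
move=> mf mg j; apply: cmeasurable_sum => k; apply: cmeasurableM.
  by split => //=; exact: mcoord2.
apply: cmeasurableM; first exact: cmeasurable_cst.
exact: cmeasurable_conv.
Qed.

Lemma stmeasurable_leray (f : R -> R3 -> C3) : stmeasurable f ->
  stmeasurable (fun t xi => leray xi (f t xi)).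
Proof.
move=> mf j; apply: cmeasurable_sum => k; apply: cmeasurableM => //.
apply: cmeasurable_real; apply: measurable_funB; first exact: measurable_cst.
apply: measurable_funM; first by apply: measurable_funM; exact: mcoord2.
(* The identity holds at the origin too, where both sides are 0 by convention. *)
have -> : (fun p : mR * mR3 => (dot p.2 p.2)^-1) = (fun p => dot p.2 p.2 `^ (-1)).
  by apply/funext => p; rewrite powR_inv1// -enorm_sqr exprn_ge0// enorm_ge0.
apply: (@measurableT_comp _ _ _ _ _ _ (@powR R ^~ (-1))); first exact: measurable_powR.
exact: (measurableT_comp (@measurable_dot_self R) measurable_snd).
Qed.

Lemma stmeasurableB (f g : R -> R3 -> C3) : stmeasurable f -> stmeasurable g ->
  stmeasurable (fun t xi j => f t xi j - g t xi j).
Proof. by move=> mf mg j; exact: cmeasurableB. Qed.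

Lemma measurable_cnorm d (T : measurableType d) (f : T -> C3) :
  (forall j, cmeasurable setT (fun x => f x j)) -> measurable_fun setT (fun x => cnorm (f x)).
Proof.
move=> mf; apply: (measurableT_comp (f := @Num.sqrt R)).
  by apply: continuous_measurable_fun; exact: sqrt_continuous.
apply: measurable_sum => j; under eq_fun do rewrite normc_sqr !expr2.
by have [m1 m2] := mf j; apply: measurable_funD; exact: measurable_funM.
Qed.

Definition extend0 (f : R -> R3 -> C3) : R -> R3 -> C3 :=
  fun t xi j => if 0 <= t then f t xi j else 0.

Lemma stmeasurable_extend0 (u : R -> vdist R) f : spacetime_hat u f ->
  stmeasurable (extend0 f).
Proof.
move=> [mf _] j; have [m1 m2] := mf j.
pose D := [set p : mR * mR3 | 0 <= (p.1 : R)].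
have mD : measurable (D : set (mR * mR3)%type).
  have -> : D = setT `&` fst @^-1` `[0, +oo[%classic.
    by apply/seteqP; split => p /=; rewrite in_itv/= andbT => // -[].
  by apply: measurable_fst => //; exact: measurable_itv.
have H (p : R[i] -> R) : p 0 = 0 -> measurable_fun D (fun q => p (f q.1 q.2 j)) ->
    measurable_fun (setT : set (mR * mR3)%type) (fun q => p (extend0 f q.1 q.2 j)).
  move=> p0 mp.
  have -> : (fun q => p (extend0 f q.1 q.2 j)) = (fun q => p (f q.1 q.2 j)) \_ D.
    apply/funext => q; rewrite /patch /extend0 /D.
    have [q0|q0] := boolP (0 <= q.1); first by rewrite mem_set.
    by rewrite memNset//=; apply/negP.
  exact/(measurable_restrictT _ mD).
by split; apply: H.
Qed.

Lemma extend0E f (t : R) : 0 <= t -> extend0 f t = f t.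
Proof. by move=> t0; apply/funext => xi; apply/funext => j; rewrite /extend0 t0. Qed.

Lemma eq_cint d (T : measurableType d) (mu : {measure set T -> \bar R}) (D : set T)
  (f g : T -> R[i]) : (forall x, D x -> f x = g x) -> cint mu D f = cint mu D g.
Proof.
move=> fg; apply: complexP; apply: eq_Rintegral => x; rewrite inE => Dx; by rewrite fg.
Qed.

(* Replacing the representatives by 0 at negative times changes none of the time
   integrals and makes them measurable on the whole space-time. *)
Lemma NS_solution_measurable (u0 : vdist R) (F u : R -> vdist R) : NS_solution u0 F u ->
  exists uh Fh : R -> R3 -> C3, [/\ stmeasurable uh, stmeasurable Fh,
    forall t : R, 0 <= t -> {ae leb3, forall xi, uh t xi = hat (u t) xi},
    forall t : R, 0 <= t -> {ae leb3, forall xi, Fh t xi = hat (F t) xi}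
  & forall t : R, 0 <= t -> {ae leb3, forall xi, forall j : 'I_3,
      uh t xi j = heat t xi * hat u0 xi j + B_hat uh uh t xi j
                      + force_hat Fh t xi j}].
Proof.
move=> [_ [uh [Fh [su sF E]]]].
exists (extend0 uh), (extend0 Fh); split.
- exact: stmeasurable_extend0 su.
- exact: stmeasurable_extend0 sF.
- by move=> t t0; rewrite extend0E//; exact: su.2 t t0.
- by move=> t t0; rewrite extend0E//; exact: sF.2 t t0.
- move=> t t0.
  have EB xi j : B_hat (extend0 uh) (extend0 uh) t xi j = B_hat uh uh t xi j.
    rewrite /B_hat; apply: f_equal; apply: eq_cint => tau /=.
    rewrite in_itv/= => /andP[tau0 _].
    by rewrite (extend0E uh tau0).
  have EF xi j : force_hat (extend0 Fh) t xi j = force_hat Fh t xi j.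
    rewrite /force_hat; apply: eq_cint => tau /=.
    rewrite in_itv/= => /andP[tau0 _].
    by rewrite (extend0E Fh tau0).
  apply: filterS (E t t0) => xi Exi j.
  by rewrite (extend0E uh t0) EB EF; exact: Exi.
Qed.

End joint_measurability.

(** * Duhamel integrals *)

Section vector_integral.
Context (d : measure_display) (T : measurableType d) (R : realType).
Variables (mu : {measure set T -> \bar R}) (D : set T).
Hypothesis mD : measurable D.

Lemma ae_le_Rintegral (f g : T -> R) : mu.-integrable D (EFin \o f) ->
  mu.-integrable D (EFin \o g) -> {ae mu, forall x, D x -> f x <= g x} ->
  Rintegral mu D f <= Rintegral mu D g.
Proof.
move=> fi gi fg; rewrite -subr_ge0 -RintegralB//.
have di : mu.-integrable D (EFin \o (fun x => g x - f x)).
  have -> : EFin \o (fun x => g x - f x) = (fun x => (EFin \o g) x - (EFin \o f) x)%E.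
    by apply/funext => x; rewrite /= EFinB.
  exact: integrableB.
rewrite /Rintegral fine_ge0//.
(* The absolute value turns an integrand that is nonnegative almost everywhere into one that is so
   everywhere. *)
have -> : (\int[mu]_(x in D) (g x - f x)%:E = \int[mu]_(x in D) (`|g x - f x|)%:E)%E.
  apply: ae_eq_integral => //.
  - exact: measurable_int di.
  - have md := measurable_int _ di; apply/measurable_EFinP.
    by apply: measurableT_comp => //; exact/measurable_EFinP.
  - apply: filterS fg => x fgx Dx; rewrite ger0_norm// subr_ge0; exact: fgx.
by apply: integral_ge0 => x _; rewrite lee_fin.
Qed.

(* Pairing the integral with itself and using Cauchy-Schwarz under the integral
   sign gives the triangle inequality for the Euclidean norm without a loss in
   the constant. *)
Lemma cnorm_cint_le (f : T -> 'I_3 -> R[i]) (g : T -> R) :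
  (forall j, cmeasurable D (fun x => f x j)) -> mu.-integrable D (EFin \o g) ->
  {ae mu, forall x, D x -> cnorm (f x) <= g x} ->
  (forall j, cintegrable mu D (fun x => f x j)) /\
  cnorm (fun j => cint mu D (fun x => f x j)) <= Rintegral mu D g.
Proof.
move=> mf ig fg.
have fi j : cintegrable mu D (fun x => f x j).
  apply: (cintegrable_le mD (mf j) ig).
  by apply: filterS fg => x fgx Dx; apply: le_trans (fgx Dx); exact: normc_le_cnorm.
split => //; set W := fun j => _.
have [W0|W0] := eqVneq (cnorm W) 0.
  rewrite W0; have := @ae_le_Rintegral (fun=> 0) g _ ig.
  rewrite /Rintegral integral0; apply; first exact: integrable0.
  by apply: filterS fg => x fgx Dx; apply: le_trans (fgx Dx); exact: cnorm_ge0.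
have Wp : 0 < cnorm W by rewrite lt_neqAle eq_sym W0 cnorm_ge0.
rewrite -(ler_pM2l Wp) -expr2 cnorm_sqr.
pose phi j x := complex.Re (W j) * complex.Re (f x j) + complex.Im (W j) * complex.Im (f x j).
have iphi j : mu.-integrable D (EFin \o phi j).
  by have [i1 i2] := fi j; apply: integrableD_EFin => //; exact: integrableZl_EFin.
have Iphi j : complex.Re (W j) * complex.Re (W j) + complex.Im (W j) * complex.Im (W j)
    = Rintegral mu D (phi j).
  have [i1 i2] := fi j; rewrite RintegralD//; [|exact: integrableZl_EFin..].
  by rewrite !RintegralZl.
rewrite /rdot; under eq_bigr do rewrite Iphi.
rewrite !big_ord_recl big_ord0 addr0.
have i12 := integrableD_EFin mD (iphi (lift ord0 ord0)) (iphi (lift ord0 (lift ord0 ord0))).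
rewrite -(RintegralD mD (iphi _) (iphi _)) -(RintegralD mD (iphi _) i12).
rewrite -RintegralZl//; apply: ae_le_Rintegral.
- exact: (integrableD_EFin mD (iphi ord0) i12).
- exact: integrableZl_EFin.
apply: filterS fg => x fgx Dx.
apply: (@le_trans _ _ (cnorm W * cnorm (f x))); last by rewrite ler_pM2l// fgx.
apply: le_trans (rdot_le W (f x)).
by rewrite /rdot !big_ord_recl big_ord0 addr0.
Qed.

End vector_integral.

(** * Duhamel integrals with a bound that changes at time T0 *)

Section duhamel.
Variable R : realType.
Local Notation mR := (measurableTypeR R).
Local Notation mR3 := (mR * mR * mR)%type.
Local Notation R3 := (R * R * R)%type.
Local Notation C3 := ('I_3 -> R[i]).
Local Notation leb1 := (@lebesgue_measure R).
Local Notation leb3 := (@leb3 R).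

(** Common form of the force term and, up to sign, of the nonlinear term. *)
Definition duhamel (N : R -> R3 -> C3) (t : R) (xi : R3) : C3 := fun j =>
  cint leb1 `[0, t] (fun tau : R => heat (t - tau) xi * N tau xi j).

Lemma cmeasurable_heat (D : set mR) (t : R) (xi : R3) :
  cmeasurable D (fun tau : mR => heat (t - tau) xi).
Proof.
apply: cmeasurable_real; apply: measurable_funTS.
by apply: continuous_measurable_fun; exact: continuous_heat.
Qed.

(** The point is uniformity in s = |xi|^2: at low frequencies the heat factor decays slowly, but the
    past contributes only 1 - e^(-T0 s) <= T0 s, and s e^(-(t - T0) s) <= 1 / (t - T0). *)
Lemma expR_decay_le (K T0 t s : R) : 0 <= K -> 0 <= T0 -> T0 < t -> 0 <= s ->
  K * (expR (- ((t - T0) * s)) - expR (- (t * s))) <= K * T0 / (t - T0).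
Proof.
move=> K0 T00 T0t s0; rewrite -mulrA ler_wpM2l//.
have tT : 0 < t - T0 by rewrite subr_gt0.
have -> : - (t * s) = - (T0 * s) - ((t - T0) * s) by ring.
rewrite expRD; set e := expR (- ((t - T0) * s)).
have e0 : 0 <= e by exact: expR_ge0.
have h1 : 1 - expR (- (T0 * s)) <= T0 * s.
  by have := expR_ge1Dx (- (T0 * s)); lra.
have h2 : ((t - T0) * s) * e <= 1.
  rewrite /e expRN ler_pdivrMr ?expR_gt0// mul1r.
  by have := expR_ge1Dx ((t - T0) * s); lra.
rewrite ler_pdivlMr//.
have : (1 - expR (- (T0 * s))) * e <= T0 * s * e by rewrite ler_wpM2r.
have : T0 * (((t - T0) * s) * e) <= T0 by rewrite ler_piMr.
move: h2 tT e0; move: (expR (- (T0 * s))) => x; move: e => e h2 tT e0 h3 h4.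
have : (e - x * e) * (t - T0) <= T0 * s * e * (t - T0).
  by rewrite ler_wpM2r ?(ltW tT)//; move: h4; lra.
by move: h3; lra.
Qed.

Variables (N : R -> R3 -> C3) (a K T0 : R).
Hypotheses (mN : stmeasurable N) (a0 : 0 <= a) (K0 : 0 <= K) (T00 : 0 <= T0).
(** A step function keeps the bound measurable in time and its integral against the heat factor
    explicit. *)
Let b (tau : R) : R := a + K * \1_(`[0, T0]%classic : set R) tau.
Hypothesis Nb : forall tau, 0 <= tau ->
  {ae leb3, forall xi, cnorm (N tau xi) <= b tau}.

Let Nb_swap : {ae leb3, forall xi, {ae leb1, forall tau, 0 <= tau -> cnorm (N tau xi) <= b tau}}.
Proof.
(* Negative times are included so that the section at every time has full measure, as [ae_swap]
   demands. *)
pose A : set (mR * mR3)%type :=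
  [set p | (p.1 : R) < 0] `|` [set p | cnorm (N p.1 p.2) - b p.1 <= 0].
have mA : measurable A.
  apply: measurableU.
    have -> : [set p : mR * mR3 | (p.1 : R) < 0] = setT `&` fst @^-1` `]-oo, 0[%classic.
      by apply/seteqP; split => p /=; rewrite in_itv/= => // -[].
    by apply: measurable_fst => //; exact: measurable_itv.
  have mh : measurable_fun (setT : set (mR * mR3)%type) (fun p => cnorm (N p.1 p.2) - b p.1).
    apply: measurable_funB; first exact: measurable_cnorm.
    apply: (measurableT_comp (f := b)) => //.
    apply: measurable_funD => //; apply: measurable_funM => //.
  have -> : [set p : mR * mR3 | cnorm (N p.1 p.2) - b p.1 <= 0] =
     setT `&` (fun p => cnorm (N p.1 p.2) - b p.1) @^-1` `]-oo, 0]%classic.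
    by apply/seteqP; split => p /=; rewrite in_itv/= => // -[].
  by apply: mh => //; exact: measurable_itv.
have hA x : {ae leb3, forall y, A (x, y)}.
  have [x0|x0] := ltP x 0; first by apply: aeW => y; left.
  by apply: filterS (Nb x0) => y h; right; rewrite /= subr_le0.
apply: filterS (ae_swap leb1 (m2 := @Defs.leb3 R) mA hA) => xi.
by apply: filterS => tau [/= h|/=]; [rewrite leNgt h|rewrite subr_le0].
Qed.

(** One exceptional set of frequencies serves all t: it comes from the coordinate planes and from
    [Nb_swap], neither of which involves t. *)
Lemma duhamel_integrable_le : {ae leb3, forall xi, forall t, T0 < t ->
  (forall j, cintegrable leb1 `[0, t] (fun tau => heat (t - tau) xi * N tau xi j)) /\
  enorm xi ^+ 2 * cnorm (duhamel N t xi) <= K * T0 / (t - T0) + a}.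
Proof.
apply: filterS2 (ae_coords_neq0 R) Nb_swap => xi /enorm_gt0 xi0 Nxi t T0t.
have s0 : 0 < dot xi xi by rewrite -enorm_sqr exprn_gt0.
set s := dot xi xi in s0.
have t0 : 0 <= t by rewrite ltW// (le_lt_trans T00).
pose h (tau : mR) := expR (- ((t - tau) * s)).
have ih c e : leb1.-integrable `[c, e] (EFin \o h) by exact: integrable_heat.
pose g (tau : mR) := a * h tau + K * (h \_ `[0, T0]) tau.
have iP : leb1.-integrable `[0, t] (EFin \o (h \_ `[0, T0])).
  rewrite -restrict_EFin; apply/integrable_restrict => //.
  by apply: integrableS (ih 0 t) => //; exact: measurableI.
have mD : measurable (`[0, t]%classic : set mR) by exact: measurable_itv.
have iah := integrableZl_EFin mD a (ih 0 t).
have iKP := integrableZl_EFin mD K iP.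
have ig : leb1.-integrable `[0, t] (EFin \o g) by exact: integrableD_EFin.
have mf j : cmeasurable (`[0, t]%classic : set mR) (fun tau : mR => heat (t - tau) xi * N tau xi j).
  apply: cmeasurableM; first exact: cmeasurable_heat.
  have [m1 m2] := cmeasurable_comp (g := fun tau : mR => (tau, xi : mR3)) (mN j)
    (measurable_fun_pair (@measurable_id _ _ _) (@measurable_cst _ _ _ _ _ _)).
  by split; apply: measurable_funTS.
have fg : {ae leb1, forall tau, `[0, t]%classic tau ->
    cnorm (fun j => heat (t - tau) xi * N tau xi j) <= g tau}.
  apply: filterS Nxi => tau Ntau; rewrite /= in_itv/= => /andP[tau0 taut].
  rewrite /heat cnorm_scale ?expR_ge0// -/s -/(h tau).
  have -> : g tau = h tau * b tau.
    rewrite /g /b /patch indicE.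
    by case: (_ \in _); rewrite ?mulr1n ?mulr0n ?mulr1 ?mulr0 ?addr0; ring.
  by rewrite ler_wpM2l ?expR_ge0// Ntau.
have [fi fle] := cnorm_cint_le mD mf ig fg.
split => //.
apply: (@le_trans _ _ (enorm xi ^+ 2 * Rintegral leb1 `[0, t] g)).
  by rewrite ler_wpM2l ?exprn_ge0 ?enorm_ge0.
rewrite enorm_sqr -/s RintegralD//.
rewrite !RintegralZl// -Rintegral_mkcondr.
have -> : `[0, t]%classic `&` `[0, T0]%classic = `[0, T0]%classic :> set mR.
  apply/seteqP; split => x /=; rewrite !in_itv/=; first by case.
  by move=> /andP[-> xT]; rewrite xT (le_trans xT)// ltW.
rewrite !Rintegral_heat//.
rewrite !subrr !subr0 mul0r oppr0 expR0.
apply: (@le_trans _ _ (K * (expR (- ((t - T0) * s)) - expR (- (t * s))) +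
    a * (1 - expR (- (t * s))))).
  have sn : s != 0 by rewrite gt_eqF.
  rewrite le_eqVlt; apply/orP; left; apply/eqP; field.
  exact: sn.
rewrite lerD//; first by apply: expR_decay_le => //; exact: ltW.
by rewrite ler_piMr// gerBl expR_ge0.
Qed.

End duhamel.

(** * Stability of solutions *)

Section stability.
Variables (R : realType) (eta eps : R).
Local Notation mR := (measurableTypeR R).
Local Notation mR3 := (mR * mR * mR)%type.
Local Notation R3 := (R * R * R)%type.
Local Notation C3 := ('I_3 -> R[i]).
Local Notation leb1 := (@lebesgue_measure R).
Local Notation leb3 := (@leb3 R).
Hypotheses (eta0 : 0 < eta) (eps0 : 0 < eps) (B_eta : B_bounded eta).

Lemma PMbound_hat (v : vdist R) (A : R) : (PMnorm 2 v <= A%:E)%E -> PMbound (hat v) A.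
Proof.
move=> /hatnorm_leP; apply: filterS => xi.
by rewrite lee_fin powR_mulrn ?enorm_ge0.
Qed.

Lemma stmeasurable_section (f : R -> R3 -> C3) t : stmeasurable f -> vmeasurable (f t).
Proof.
move=> mf j; have := mf j.
have m2 : measurable_fun setT (fun xi : mR3 => (t : mR, xi)).
  exact: measurable_fun_pair.
by move/(cmeasurable_comp (g := fun xi : mR3 => (t : mR, xi))); apply.
Qed.

Definition NSsymbol (f : R3 -> C3) : R3 -> C3 := fun xi =>
  leray xi (div_tensor_hat f f xi).

Lemma NSsymbol_le (a : vdist R) (f : R3 -> C3) (A : R) : PM 2 a ->
  (PMnorm 2 a <= A%:E)%E -> vmeasurable f -> {ae leb3, forall xi, f xi = hat a xi} ->
  {ae leb3, forall xi, cnorm (NSsymbol f xi) <= eta * A * A}.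
Proof.
move=> Pa aA mf fa; apply: filterS (bilinear_symbol_le B_eta Pa Pa aA aA (ltW eta0)) => xi.
rewrite /NSsymbol (@eq_ae_div_tensor_hat _ f (hat a) f (hat a))//; exact: vmeasurable_hat Pa.
Qed.

(** Each of the two terms of the bilinear splitting contains the difference once. The symbol bound
    is applied to the distribution [a - b], whose [hat] is exchanged for the difference of the
    representatives inside the convolutions. *)
Lemma NSsymbol_diff_le (a b : vdist R) (f g : R3 -> C3) (A B W : R) : PM 2 a -> PM 2 b ->
  (PMnorm 2 a <= A%:E)%E -> (PMnorm 2 b <= B%:E)%E -> (PMnorm 2 (a - b)%R <= W%:E)%E ->
  vmeasurable f -> vmeasurable g ->
  {ae leb3, forall xi, f xi = hat a xi} -> {ae leb3, forall xi, g xi = hat b xi} ->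
  {ae leb3, forall xi, cnorm (fun j => NSsymbol f xi j - NSsymbol g xi j)
     <= eta * A * W + eta * W * B}.
Proof.
move=> Pa Pb aA bB abW mf mg fa gb.
have Pab := PMB Pa Pb.
have [ma mb mab] := And3 (vmeasurable_hat Pa) (vmeasurable_hat Pb) (vmeasurable_hat Pab).
have h1 := bilinear_symbol_le B_eta Pa Pab aA abW (ltW eta0).
have h2 := bilinear_symbol_le B_eta Pab Pb abW bB (ltW eta0).
apply: filterS3 h1 h2 (ae_coords_neq0 R) => xi h1 h2 xi0.
rewrite /NSsymbol (@eq_ae_div_tensor_hat _ f (hat a) f (hat a))//.
rewrite (@eq_ae_div_tensor_hat _ g (hat b) g (hat b))//.
pose w xi j := hat a xi j - hat b xi j.
have mw : vmeasurable w by exact: vmeasurableB.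
have Ew : {ae leb3, forall xi, w xi = hat (a - b) xi}.
  by apply: filterS (hatB Pa Pb) => y ->.
have E1 : div_tensor_hat (hat a) (hat (a - b)) xi = div_tensor_hat (hat a) w xi.
  apply: eq_ae_div_tensor_hat => //; first exact: aeW.
  by apply: filterS Ew => y ->.
have E2 : div_tensor_hat (hat (a - b)) (hat b) xi = div_tensor_hat w (hat b) xi.
  apply: eq_ae_div_tensor_hat => //; last exact: aeW.
  by apply: filterS Ew => y ->.
have D := div_tensor_hat_diff ma mb (PMbound_hat aA) (PMbound_hat bB) xi0.
have -> : (fun j => leray xi (div_tensor_hat (hat a) (hat a) xi) j
      - leray xi (div_tensor_hat (hat b) (hat b) xi) j) =
  (fun j => leray xi (div_tensor_hat (hat a) (hat (a - b)) xi) j +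
      leray xi (div_tensor_hat (hat (a - b)) (hat b) xi) j).
  apply/funext => j; rewrite E1 E2.
  have <- := @lerayB _ xi _ _ (fun j => _) (fun j => erefl) j.
  by apply: lerayD => i; exact: D.
by apply: le_trans (cnormD _ _) _; exact: lerD.
Qed.

Lemma leray_diff_le (a b : vdist R) (f g : R3 -> C3) (W : R) : PM 0 a -> PM 0 b ->
  (PMnorm 0 (a - b)%R <= W%:E)%E ->
  {ae leb3, forall xi, f xi = hat a xi} -> {ae leb3, forall xi, g xi = hat b xi} ->
  {ae leb3, forall xi, cnorm (fun j => leray xi (f xi) j - leray xi (g xi) j) <= 18 * W}.
Proof.
move=> Pa Pb /hatnorm_leP H fa gb.
apply: filterS2 (filterI fa gb) (filterI H (hatB Pa Pb)) => xi [-> ->] [+ Eab].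
rewrite Eab lee_fin powRr0 mul1r => HW.
have -> : (fun j => leray xi (hat a xi) j - leray xi (hat b xi) j) =
    leray xi (fun j => hat a xi j - hat b xi j).
  by apply/funext => j; apply/esym; exact: lerayB.
by apply: le_trans (leray_le _ _) _; rewrite ler_pM2l.
Qed.

Lemma leray_hat_le (a : vdist R) (f : R3 -> C3) (W : R) :
  (PMnorm 0 a <= W%:E)%E -> {ae leb3, forall xi, f xi = hat a xi} ->
  {ae leb3, forall xi, cnorm (leray xi (f xi)) <= 18 * W}.
Proof.
move=> /hatnorm_leP H fa; apply: filterS2 H fa => xi + ->.
rewrite lee_fin powRr0 mul1r => HW.
by apply: le_trans (leray_le _ _) _; rewrite ler_pM2l.
Qed.

(** Applied to each solution and each force separately, so that a difference of Duhamel integrals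
    becomes the integral of the difference. *)
Lemma duhamel_integrable (N : R -> R3 -> C3) (a : R) : stmeasurable N -> 0 <= a ->
  (forall tau, 0 <= tau -> {ae leb3, forall xi, cnorm (N tau xi) <= a}) ->
  {ae leb3, forall xi, forall t, 0 < t ->
    forall j, cintegrable leb1 `[0, t] (fun tau => heat (t - tau) xi * N tau xi j)}.
Proof.
move=> mN a0 Na.
have Na' tau : 0 <= tau ->
    {ae leb3, forall xi, cnorm (N tau xi) <= a + 0 * \1_(`[0, 0]%classic : set R) tau}.
  by move=> tau0; apply: filterS (Na tau tau0) => xi; rewrite mul0r addr0.
apply: filterS (duhamel_integrable_le mN a0 (lexx 0) (lexx 0) Na') => xi H t.
by move=> /H[].
Qed.

Lemma duhamelB (M N : R -> R3 -> C3) t xi :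
  (forall j, cintegrable leb1 `[0, t] (fun tau => heat (t - tau) xi * M tau xi j)) ->
  (forall j, cintegrable leb1 `[0, t] (fun tau => heat (t - tau) xi * N tau xi j)) ->
  forall j, duhamel (fun tau xi j => M tau xi j - N tau xi j) t xi j =
    duhamel M t xi j - duhamel N t xi j.
Proof.
move=> iM iN j; rewrite /duhamel -cintB//.
by congr (cint _ _ _); apply/funext => tau; rewrite mulrBr.
Qed.

Variables (u0 v0 : vdist R) (F G u v : R -> vdist R).
Hypotheses (Pu0 : PM 2 u0) (Pv0 : PM 2 v0) (CF : CwPM 0 F) (CG : CwPM 0 G)
  (su : NS_solution u0 F u) (sv : NS_solution v0 G v)
  (u2 : (CwPMnorm 2 u <= (2 * eps)%:E)%E) (v2 : (CwPMnorm 2 v <= (2 * eps)%:E)%E)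
  (Fe : (CwPMnorm 0 F <= eps%:E)%E) (Ge : (CwPMnorm 0 G <= eps%:E)%E).

(** The two terms of the splitting add up to eta (2 eps) w + eta w (2 eps) = q w, and [M] is the
    bound on the difference of two solutions of norm at most 2 eps. *)
Let q := 4 * eta * eps.
Let M := 4 * eps.

Lemma PMnorm_solution_diff_le t : 0 <= t -> (PMnorm 2 (u t - v t)%R <= M%:E)%E.
Proof.
move=> t0; have [[Pu _ _] _] := su; have [[Pv _ _] _] := sv.
apply: (@le_trans _ _ (PMnorm 2 (u t) + PMnorm 2 (v t))%E).
  apply: hatnormD_le; apply: filterS (hatB (Pu t t0) (Pv t t0)) => xi ->.
  exact: cnormB.
have -> : M = 2 * eps + 2 * eps by rewrite /M; ring.
rewrite EFinD; apply: leeD.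
- by move/hatnormX_leP: u2; apply.
- by move/hatnormX_leP: v2; apply.
Qed.

Lemma PMnorm_force_diff_le t : 0 <= t -> (PMnorm 0 (F t - G t)%R <= (2 * eps)%:E)%E.
Proof.
move=> t0; have [PF _ _] := CF; have [PG _ _] := CG.
apply: (@le_trans _ _ (PMnorm 0 (F t) + PMnorm 0 (G t))%E).
  apply: hatnormD_le; apply: filterS (hatB (PF t t0) (PG t t0)) => xi ->.
  exact: cnormB.
have -> : 2 * eps = eps + eps by ring.
rewrite EFinD; apply: leeD.
- by move/hatnormX_leP: Fe; apply.
- by move/hatnormX_leP: Ge; apply.
Qed.

Lemma solution_diff_le (T0 a delta t : R) : 0 <= T0 -> 0 <= a -> 0 <= delta -> T0 < t ->
  (forall tau, T0 <= tau -> (PMnorm 2 (u tau - v tau)%R <= a%:E)%E) ->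
  (forall tau, T0 <= tau -> (PMnorm 0 (F tau - G tau)%R <= delta%:E)%E) ->
  (PMnorm 2 (u t - v t)%R <= hatnorm 2 (heat_hat t (u0 - v0)%R) +
     ((q * M * T0 / (t - T0) + q * a) + (36 * eps * T0 / (t - T0) + 18 * delta))%R%:E)%E.
Proof.
move=> T00 a0 d0 T0t wa fd.
have [[Pu _ _] _] := su; have [[Pv _ _] _] := sv.
have [PF _ _] := CF; have [PG _ _] := CG.
have [uh [Fh [muh mFh Euh EFh Eu]]] := NS_solution_measurable su.
have [vh [Gh [mvh mGh Evh EGh Ev]]] := NS_solution_measurable sv.
pose Lu tau := NSsymbol (uh tau); pose Lv tau := NSsymbol (vh tau).
pose PF' tau xi := leray xi (Fh tau xi); pose PG' tau xi := leray xi (Gh tau xi).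
have mLu : stmeasurable Lu by apply: stmeasurable_leray; exact: stmeasurable_div_tensor.
have mLv : stmeasurable Lv by apply: stmeasurable_leray; exact: stmeasurable_div_tensor.
have mPF : stmeasurable PF' by exact: stmeasurable_leray.
have mPG : stmeasurable PG' by exact: stmeasurable_leray.
have u2t tau : 0 <= tau -> (PMnorm 2 (u tau) <= (2 * eps)%:E)%E.
  by move=> ?; move/hatnormX_leP: u2; apply.
have v2t tau : 0 <= tau -> (PMnorm 2 (v tau) <= (2 * eps)%:E)%E.
  by move=> ?; move/hatnormX_leP: v2; apply.
have e2 : 0 <= eta * (2 * eps) * (2 * eps) by rewrite !mulr_ge0// ltW.
have e18 : 0 <= 18 * eps by rewrite mulr_ge0// ltW.
have iLu := @duhamel_integrable Lu _ mLu e2 (fun tau h =>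
  NSsymbol_le (Pu tau h) (u2t tau h) (stmeasurable_section tau muh) (Euh tau h)).
have iLv := @duhamel_integrable Lv _ mLv e2 (fun tau h =>
  NSsymbol_le (Pv tau h) (v2t tau h) (stmeasurable_section tau mvh) (Evh tau h)).
have iPF : {ae leb3, forall xi, forall t, 0 < t ->
    forall j, cintegrable leb1 `[0, t] (fun tau => heat (t - tau) xi * PF' tau xi j)}.
  apply: duhamel_integrable e18 _ => // tau h; apply: leray_hat_le (EFh tau h).
  by move/hatnormX_leP: Fe; apply.
have iPG : {ae leb3, forall xi, forall t, 0 < t ->
    forall j, cintegrable leb1 `[0, t] (fun tau => heat (t - tau) xi * PG' tau xi j)}.
  apply: duhamel_integrable e18 _ => // tau h; apply: leray_hat_le (EGh tau h).
  by move/hatnormX_leP: Ge; apply.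
have q0 : 0 <= q by rewrite !mulr_ge0// ltW.
have M0 : 0 <= M by rewrite mulr_ge0// ltW.
have indE (tau : R) : 0 <= tau ->
    \1_(`[0, T0]%classic : set R) tau = (tau <= T0)%R%:R :> R.
  by move=> tau0; rewrite indicE; congr (_%:R); rewrite mem_setE/= in_itv/= tau0.
have bL : {ae leb3, forall xi, forall t, T0 < t ->
    (forall j, cintegrable leb1 `[0, t]
      (fun tau => heat (t - tau) xi * (Lu tau xi j - Lv tau xi j))) /\
    enorm xi ^+ 2 * cnorm (duhamel (fun tau xi j => Lu tau xi j - Lv tau xi j) t xi)
      <= q * M * T0 / (t - T0) + q * a}.
  apply: (@duhamel_integrable_le _ (fun tau xi j => Lu tau xi j - Lv tau xi j)) => //.
  - exact: stmeasurableB.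
  - exact: mulr_ge0.
  - exact: mulr_ge0.
  - move=> tau tau0; rewrite indE//.
    (* The a priori bound serves up to T0, the assumed one afterwards; q W is then at most q a plus
       q M times the indicator of [0, T0]. *)
    pose W := if tau <= T0 then M else a.
    have hW : (PMnorm 2 (u tau - v tau)%R <= W%:E)%E.
      rewrite /W; case: (leP tau T0) => [_|/ltW Tt]; last exact: wa.
      exact: PMnorm_solution_diff_le.
    have := NSsymbol_diff_le (Pu tau tau0) (Pv tau tau0) (u2t tau tau0) (v2t tau tau0) hW
      (stmeasurable_section tau muh) (stmeasurable_section tau mvh) (Euh tau tau0) (Evh tau tau0).
    apply: filterS => xi; move/le_trans; apply.
    have -> : eta * (2 * eps) * W + eta * W * (2 * eps) = q * W by rewrite /q; ring.
    rewrite /W; case: (leP tau T0) => _; rewrite ?mulr1 ?mulr0 ?addr0//.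
    by rewrite lerDr mulr_ge0.
have bP : {ae leb3, forall xi, forall t, T0 < t ->
    (forall j, cintegrable leb1 `[0, t]
      (fun tau => heat (t - tau) xi * (PF' tau xi j - PG' tau xi j))) /\
    enorm xi ^+ 2 * cnorm (duhamel (fun tau xi j => PF' tau xi j - PG' tau xi j) t xi)
      <= 36 * eps * T0 / (t - T0) + 18 * delta}.
  apply: (@duhamel_integrable_le _ (fun tau xi j => PF' tau xi j - PG' tau xi j)) => //.
  - exact: stmeasurableB.
  - exact: mulr_ge0.
  - by rewrite mulr_ge0// ltW.
  - move=> tau tau0; rewrite indE//.
    pose W := if tau <= T0 then 2 * eps else delta.
    have hW : (PMnorm 0 (F tau - G tau)%R <= W%:E)%E.
      rewrite /W; case: (leP tau T0) => [_|/ltW Tt]; last exact: fd.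
      exact: PMnorm_force_diff_le.
    have := leray_diff_le (PF tau tau0) (PG tau tau0) hW (EFh tau tau0) (EGh tau tau0).
    apply: filterS => xi; move/le_trans; apply.
    rewrite /W; case: (leP tau T0) => _; rewrite ?mulr1 ?mulr0 ?addr0//.
    have -> : 18 * (2 * eps) = 36 * eps by ring.
    by rewrite lerDr mulr_ge0.
have t0 : 0 <= t by rewrite ltW// (le_lt_trans T00).
have tp : 0 < t by rewrite (le_lt_trans T00).
apply/hatnorm_leP.
have /hatnorm_leP Hheat := lexx (hatnorm 2 (heat_hat t (u0 - v0))).
have aeI := fun P Q => @filterI _ _ (@leb3_ae_filter R) P Q.
have H1 := aeI _ _ (Eu t t0) (Ev t t0).
have H2 := aeI _ _ (Euh t t0) (Evh t t0).
have H3 := aeI _ _ (hatB (Pu t t0) (Pv t t0)) (hatB Pu0 Pv0).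
have H4 := aeI _ _ iLu iLv.
have H5 := aeI _ _ iPF iPG.
have H6 := aeI _ _ bL bP.
have H7 := aeI _ _ (aeI _ _ H1 H2) (aeI _ _ H3 H4).
apply: filterS3 H7 Hheat (aeI _ _ H5 H6)
  => xi [[[hu hv] [hu' hv']] [[-> h0] [jLu jLv]]] Hh [[jF jG] [kL kP]].
have [_ lL] := kL t T0t; have [_ lP] := kP t T0t.
set d1 := duhamel _ t xi in lL; set d2 := duhamel _ t xi in lP.
have E : (fun j => hat (u t) xi j - hat (v t) xi j) =
    (fun j => (heat_hat t (u0 - v0) xi j + - d1 j) + d2 j).
  apply/funext => j; rewrite -hu' -hv' hu hv /heat_hat h0.
  have -> : d1 j = duhamel Lu t xi j - duhamel Lv t xi j.
    by apply: duhamelB => i; [exact: jLu|exact: jLv].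
  have -> : d2 j = duhamel PF' t xi j - duhamel PG' t xi j.
    by apply: duhamelB => i; [exact: jF|exact: jG].
  rewrite -[B_hat uh uh t xi j]/(- duhamel Lu t xi j).
  rewrite -[B_hat vh vh t xi j]/(- duhamel Lv t xi j).
  rewrite -[force_hat Fh t xi j]/(duhamel PF' t xi j).
  rewrite -[force_hat Gh t xi j]/(duhamel PG' t xi j).
  move: (duhamel Lu _ _ _) (duhamel Lv _ _ _) (duhamel PF' _ _ _) (duhamel PG' _ _ _).
  move: (heat _ _) (hat u0 _ _) (hat v0 _ _) => h x y x1 x2 x3 x4; ring.
rewrite E; apply: (@le_trans _ _ ((enorm xi `^ 2 * cnorm (heat_hat t (u0 - v0) xi))%:E +
   (enorm xi ^+ 2 * cnorm d1 + enorm xi ^+ 2 * cnorm d2)%:E)%E).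
  rewrite -EFinD lee_fin powR_mulrn ?enorm_ge0// -!mulrDr ler_wpM2l ?exprn_ge0 ?enorm_ge0//.
  apply: le_trans (cnormD (fun j => heat_hat t (u0 - v0) xi j + - d1 j) d2) _.
  rewrite addrA lerD2r -(cnormN d1); exact: cnormD.
by apply: leeD => //; rewrite lee_fin; exact: lerD.
Qed.

End stability.

(** * Limits at infinity as eventual bounds *)

Section limits.
Variable R : realType.

Lemma eventually_le_of_cvg0 (f : R -> \bar R) (e : R) : f t @[t --> +oo] --> 0%E -> 0 < e ->
  exists T, 0 <= T /\ forall t, T <= t -> (f t <= e%:E)%E.
Proof.
move=> /fine_cvgP[ff f0] e0.
have : \forall t \near pinfty_nbhs R, (f t <= e%:E)%E.
  apply: filterS2 ff (cvgr0_norm_le _ f0 _ e0) => t ft fle.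
  by rewrite -(fineK ft) lee_fin (le_trans (ler_norm _)).
(* The neighbourhood of +oo controls only t > T; adding 1 allows the non-strict inequality. *)
move=> [T [_ HT]]; exists (Num.max 0 T + 1); split.
  by rewrite addr_ge0// le_max lexx.
move=> t Tt; apply: HT; apply: lt_le_trans Tt.
by rewrite ltr_pwDr// le_max lexx orbT.
Qed.

Lemma cvg0_of_eventually_le (f : R -> \bar R) : (forall t, 0 <= f t)%E ->
  (forall e, 0 < e -> exists T, forall t, T <= t -> (f t <= e%:E)%E) ->
  f t @[t --> +oo] --> 0%E.
Proof.
move=> f0 fe.
have H e : 0 < e -> \forall t \near pinfty_nbhs R, (f t <= e%:E)%E.
  move=> /fe[T HT]; exists T; split; first exact: num_real.
  by move=> t Tt; apply: HT; exact: ltW.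
have fin t (e : R) : (f t <= e%:E)%E -> f t \is a fin_num.
  by move=> fte; rewrite ge0_fin_numE// (le_lt_trans fte)// ltry.
apply/fine_cvgP; split.
  by apply: filterS (H 1 ltr01) => t; exact: fin.
apply/cvgr0Pnorm_le => e e0; apply: filterS (H e e0) => t fte.
rewrite ger0_norm; last by rewrite /= fine_ge0.
by rewrite -lee_fin /= fineK// (fin _ _ fte).
Qed.

End limits.

Theorem theorem5p1 (R : realType) (eta eps : R)
    (u0 v0 : vdist R) (F G u v : R -> vdist R) :
  0 < eta -> B_bounded eta ->
  0 < eps -> eps < 1 / (4 * eta) ->
  PM 2 u0 -> PM 2 v0 -> CwPM 0 F -> CwPM 0 G ->
  (PMnorm 2 u0 + CwPMnorm 0 F < eps%:E)%E ->
  (PMnorm 2 v0 + CwPMnorm 0 G < eps%:E)%E ->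
  NS_solution u0 F u -> (CwPMnorm 2 u <= (2 * eps)%:E)%E ->
  NS_solution v0 G v -> (CwPMnorm 2 v <= (2 * eps)%:E)%E ->
  hatnorm 2 (heat_hat t (u0 - v0)) @[t --> +oo] --> 0%E ->
  PMnorm 0 (F t - G t) @[t --> +oo] --> 0%E ->
  PMnorm 2 (u t - v t) @[t --> +oo] --> 0%E.
Proof.
move=> eta0 B_eta eps0 epslt Pu0 Pv0 CF CG uF vG su u2 sv v2 heat0 force0.
have Fe : (CwPMnorm 0 F <= eps%:E)%E.
  by apply: le_trans (ltW uF); apply: leeDr; exact: hatnorm_ge0.
have Ge : (CwPMnorm 0 G <= eps%:E)%E.
  by apply: le_trans (ltW vG); apply: leeDr; exact: hatnorm_ge0.
set q := 4 * eta * eps; set M := 4 * eps.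
have q0 : 0 < q by rewrite !mulr_gt0.
have q1 : q < 1.
  by move: epslt; rewrite ltr_pdivlMr ?mulr_gt0// mulrC.
have M0 : 0 < M by rewrite mulr_gt0.
pose P a := exists T, 0 <= T /\ forall t, T <= t -> (PMnorm 2 (u t - v t)%R <= a%:E)%E.
have step a e : 0 <= a -> 0 < e -> P a -> P (q * a + e).
  move=> a0 e0 [T1 [T10 HT1]].
  (* The heat term takes e/4, the force after T0 takes 18 (e/72) = e/4, and the times before T0 take
     e/4. *)
  have e4 : 0 < e / 4 by rewrite divr_gt0.
  have e72 : 0 < e / 72 by rewrite divr_gt0.
  have [T2 [T20 HT2]] := eventually_le_of_cvg0 heat0 e4.
  have [T3 [T30 HT3]] := eventually_le_of_cvg0 force0 e72.
  pose T0 := Num.max T1 T3.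
  have T00 : 0 <= T0 by rewrite le_max T10.
  pose C := q * M * T0 + 36 * eps * T0.
  have C0 : 0 <= C.
    by rewrite addr_ge0// mulr_ge0// mulr_ge0// ltW.
  (* The summand 1 gives T0 < t strictly; the last summand gives C / (t - T0) <= e/4. *)
  exists (Num.max T2 (T0 + 1 + C / (e / 4))); split; first by rewrite le_max T20.
  move=> t; rewrite ge_max => /andP[T2t Tt].
  have Cd : 0 <= C / (e / 4) by rewrite divr_ge0// ltW.
  have T0t : T0 < t by lra.
  have tT0 : 0 < t - T0 by rewrite subr_gt0.
  apply: le_trans (solution_diff_le eta0 eps0 B_eta Pu0 Pv0 CF CG su sv u2 v2 Fe Ge
     T00 a0 (ltW e72) T0t _ _) _.
  - by move=> tau h; apply: HT1; apply: le_trans h; rewrite le_max lexx.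
  - by move=> tau h; apply: HT3; apply: le_trans h; rewrite le_max lexx orbT.
  apply: le_trans (leeD (HT2 t T2t) (lexx _)) _.
  rewrite -EFinD lee_fin -/q -/M.
  have : C / (t - T0) <= e / 4.
    rewrite ler_pdivrMr// mulrC -ler_pdivrMr//; lra.
  have -> : C / (t - T0) = q * M * T0 / (t - T0) + 36 * eps * T0 / (t - T0).
    by rewrite /C mulrDl.
  move: (q * M * T0 / _) (36 * eps * T0 / _) (q * a) => x y z; lra.
have iter (e : R) n : 0 < e -> P (q ^+ n * M + e).
  move=> e0; elim: n => [|n IH].
    exists 0; split => // t t0; rewrite expr0 mul1r.
    apply: le_trans (PMnorm_solution_diff_le su sv u2 v2 t0) _.
    by rewrite lee_fin -/M lerDl ltW.
  (* Spending only (1 - q) e at each step keeps the error equal to e instead of letting it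
     accumulate. *)
  have -> : q ^+ n.+1 * M + e = q * (q ^+ n * M + e) + (1 - q) * e by rewrite exprS; ring.
  apply: step IH; last by rewrite mulr_gt0// subr_gt0.
  by rewrite addr_ge0 ?mulr_ge0 ?exprn_ge0// ltW.
apply: cvg0_of_eventually_le => [t|e e0]; first exact: hatnorm_ge0.
have e2 : 0 < e / 2 by rewrite divr_gt0.
have cq : q ^+ n * M @[n --> \oo] --> (0 : R).
  rewrite -[X in _ --> X](mul0r M); apply: cvgMl; apply: cvg_expr.
  by rewrite ger0_norm// ltW.
have [n _ /(_ n (leqnn n)) /= hn] := cvgr0_norm_le _ cq _ e2.
have [T [_ HT]] := iter (e / 2) n e2.
exists T => t Tt; apply: le_trans (HT t Tt) _; rewrite lee_fin.
by have := le_trans (ler_norm _) hn; lra.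
Qed.
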